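(* For every integer $n\ge1$, the number of tatami tilings of the $n\times n$ grid with exactly $n$ monomers is $T(n,n,n)=n2^{n-1}$.
   Context: A tatami tiling of the $r\times c$ rectangular grid is a tiling by monomers ($1\times1$ tiles) and dimers ($1\times2$ or $2\times1$ tiles) such that no point is a corner of four distinct tiles. $T(r,c,m)$ denotes the number of tatami tilings of the $r\times c$ grid with exactly $m$ monomers. *)

(* Defs.v *)
From mathcomp Require Import all_boot.
Set Implicit Arguments. Unset Strict Implicit. Unset Printing Implicit Defensive.

Definition cell (r c : nat) := ('I_r * 'I_c)%type.

Definition adjacent (r c : nat) (x y : cell r c) : bool :=
  ((x.1 == y.1 :> nat) && ((x.2.+1 == y.2 :> nat) || (y.2.+1 == x.2 :> nat))) ||
  ((x.2 == y.2 :> nat) && ((x.1.+1 == y.1 :> nat) || (y.1.+1 == x.1 :> nat))).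

Definition is_monomer (r c : nat) (B : {set cell r c}) : bool := #|B| == 1.

Definition is_dimer (r c : nat) (B : {set cell r c}) : bool :=
  [exists x : cell r c, exists y : cell r c, (B == [set x; y]) && adjacent x y].

Definition mono_dimer_tiling (r c : nat) (P : {set {set cell r c}}) : bool :=
  partition P [set: cell r c] &&
  [forall B in P, is_monomer B || is_dimer B].

(* Tatami condition: no interior grid point is a corner of four distinct
   tiles, i.e. the four cells around it lie in fewer than four tiles. *)
Definition tatami_cond (r c : nat) (P : {set {set cell r c}}) : bool :=
  [forall i1 : 'I_r, forall i2 : 'I_r, forall j1 : 'I_c, forall j2 : 'I_c,
     ((i1.+1 == i2 :> nat) && (j1.+1 == j2 :> nat)) ==>
     (#|pblock P @: [set (i1, j1); (i1, j2); (i2, j1); (i2, j2)]| < 4)].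

Definition tatami (r c : nat) (P : {set {set cell r c}}) : bool :=
  mono_dimer_tiling P && tatami_cond P.

Definition num_monomers (r c : nat) (P : {set {set cell r c}}) : nat :=
  #|[set B in P | is_monomer B]|.

Definition T (r c m : nat) : nat :=
  #|[set P : {set {set cell r c}} | tatami P && (num_monomers P == m)]|.

(* Main.v *)
From Stdlib Require Import ZArith Lia FunctionalExtensionality.
Require Import Defs.
From mathcomp Require Import all_boot zify.
Set Implicit Arguments. Unset Strict Implicit. Unset Printing Implicit Defensive.

(* Put N = n - 1 and look at the N x N interior grid points. A dimer covers one
   or two of them with the midpoints of its long sides; being tatami means that
   every interior point is covered, so it gets a direction up, down, left or
   right, towards the dimer covering it. A vertical direction next to a
   horizontal one starts a ray, a staircase of dimers which is forced to run
   diagonally to the boundary.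

   Peeling off concentric rings of points, a double count along each of the four
   sides shows that there are at most n monomers, and that equality forces every
   ray which ends on one side to start on another one: all rays are full
   diagonal chords. A field with this property is determined by its directions
   on the two main diagonals of the square, and can be written down explicitly:
   a brick pattern of parallel dimers around the centre in which some diagonal
   strips, of two transversal families, have been flipped. Up to the four
   possibilities for the centre, a tiling is a pair (A, B) of subsets of
   {0, ..., n - 3} of flipped strips, and the condition that no two flipped
   strips cross says that all of B (reversed) lies before all of A. There are
   n * 2 ^ (n - 3) such pairs. *)

(** * Fields of dimers *)

(** With n monomers the dimers cover N^2 + N cells, and this number is the sum over the rings, of
    side N, N - 2, ..., of 4 * side - 2 (of 2 for a single point). On one side of a ring, weigh a
    point by 2, 1 or 0 for each dimer covering it from outside, sideways or inside. If no point is
    covered twice, two neighbours weigh 2 together, with one less where a ray starts and one more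
    where a ray ends. The rays starting on a side end, injectively, on adjacent sides, so every
    deficit is paid for. Equality in the outermost ring is already enough for the chords: a ray met
    anywhere leaves through the border, its exit forces an entry on the border, and the staircase
    from that entry runs through the place where the ray was met. The same equality rules out points
    covered twice. Conversely, coverage exactly once and full chords turn every inequality of the
    count into an equality. The tilings with n monomers are therefore exactly the good fields, and
    what remains is to classify these. Transposition and the half turn reduce the four centres to
    one. The grid with n = 1 has no interior point and is treated apart. *)

(* [eh i j]: the cells (i,j) and (i,j+1) form a dimer; [ev i j]: the cells (i,j)
   and (i+1,j) do. The interior grid point (i,j) is the common corner of the
   cells (i,j), (i,j+1), (i+1,j), (i+1,j+1); [up], [dn], [lf], [rt] say that it
   is covered by the dimer above it, below it, to its left or right. Indices
   in Z make the reflections of the square total. *)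
Record field := Field { eh : Z -> Z -> bool; ev : Z -> Z -> bool }.

Definition up f i j := eh f i j.
Definition dn f i j := eh f (i + 1)%Z j.
Definition lf f i j := ev f i j.
Definition rt f i j := ev f i (j + 1)%Z.

Definition tr f := Field (fun i j => ev f j i) (fun i j => eh f j i).
(** The points are reflected by j -> c - j. The column index of [eh] is that of a point, but the
    column index of [ev] is that of a cell, and cell columns are reflected by j -> c + 1 - j. *)
Definition hflip c f :=
  Field (fun i j => eh f i (c - j)%Z) (fun i j => ev f i (c + 1 - j)%Z).
Definition turn c f := tr (hflip c f).

Definition sq a b i j := (a <= i <= b /\ a <= j <= b)%Z.

(* No cell lies in two dimers. *)
Record matching f : Prop := Matching {
  hh : forall i j j', (j' = j + 1)%Z -> eh f i j -> eh f i j' -> False;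
  vv : forall i i' j, (i' = i + 1)%Z -> ev f i j -> ev f i' j -> False;
  hv : forall i j i' j', (i' = i \/ i' = i + 1)%Z -> (j' = j \/ j' = j + 1)%Z ->
    eh f i' j -> ev f i j' -> False }.

Definition covers a b f := forall i j, sq a b i j ->
  [|| up f i j, dn f i j, lf f i j | rt f i j].

Ltac ueq := rewrite /up /dn /lf /rt /=; f_equal; lia.

Section Access.
Variables (c : Z) (f : field).
Lemma up_tr i j : up (tr f) i j = lf f j i. Proof. by []. Qed.
Lemma dn_tr i j : dn (tr f) i j = rt f j i. Proof. by []. Qed.
Lemma lf_tr i j : lf (tr f) i j = up f j i. Proof. by []. Qed.
Lemma rt_tr i j : rt (tr f) i j = dn f j i. Proof. by []. Qed.
Lemma up_hflip i j : up (hflip c f) i j = up f i (c - j). Proof. by []. Qed.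
Lemma dn_hflip i j : dn (hflip c f) i j = dn f i (c - j). Proof. by []. Qed.
Lemma lf_hflip i j : lf (hflip c f) i j = rt f i (c - j). Proof. ueq. Qed.
Lemma rt_hflip i j : rt (hflip c f) i j = lf f i (c - j). Proof. ueq. Qed.
End Access.
Definition accE :=
  (up_tr, dn_tr, lf_tr, rt_tr, up_hflip, dn_hflip, lf_hflip, rt_hflip).

Lemma field_ext f g :
  (forall i j, eh f i j = eh g i j) -> (forall i j, ev f i j = ev g i j) -> f = g.
Proof.
case: f g => [h v] [h' v'] /= Hh Hv; f_equal;
  by apply: functional_extensionality => i; apply: functional_extensionality.
Qed.

Lemma trK : involutive tr. Proof. by case. Qed.

Lemma hflipK c : involutive (hflip c).
Proof. by move=> f; apply: field_ext => i j /=; f_equal; lia. Qed.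

Lemma turn4 c f : turn c (turn c (turn c (turn c f))) = f.
Proof. by apply: field_ext => i j /=; f_equal; lia. Qed.

Lemma turn_hflip c f : turn c (hflip c (turn c f)) = hflip c f.
Proof. by apply: field_ext => i j /=; f_equal; lia. Qed.

Lemma matching_tr f : matching f -> matching (tr f).
Proof.
case=> H V X; split => /= i j k.
- by move=> e h1 h2; apply: V h1 h2.
- by move=> e h1 h2; apply: H h1 h2.
- by move=> l e1 e2 h1 h2; apply: X h2 h1.
Qed.

Lemma matching_hflip c f : matching f -> matching (hflip c f).
Proof.
case=> H V X; split => /= i j k.
- by move=> e h1 h2; apply: H h2 h1; lia.
- by move=> e h1 h2; apply: V h1 h2; lia.
- move=> l e1 e2 h1 h2.
  by apply: X h1 h2; lia.
Qed.

Lemma matching_turn c f : matching f -> matching (turn c f).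
Proof. by move=> m; apply/matching_tr/matching_hflip. Qed.

Lemma covers_tr a b f : covers a b f -> covers a b (tr f).
Proof.
move=> H i j s; have := H j i; rewrite !accE => Hc.
by case/or4P: (Hc ltac:(unfold sq in *; lia)) => ->; rewrite ?orbT.
Qed.

Lemma covers_hflip a b f : covers a b f -> covers a b (hflip (a + b) f).
Proof.
move=> H i j s; have := H i (a + b - j)%Z; rewrite !accE => Hc.
by case/or4P: (Hc ltac:(unfold sq in *; lia)) => ->; rewrite ?orbT.
Qed.

Lemma covers_turn a b f : covers a b f -> covers a b (turn (a + b) f).
Proof. by move=> m; apply/covers_tr/covers_hflip. Qed.

Lemma covers_sub a b a' b' f : (a <= a')%Z -> (b' <= b)%Z ->
  covers a b f -> covers a' b' f.
Proof. by move=> h1 h2 H i j s; apply: H; unfold sq in *; lia. Qed.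

(* The ray: the staircase [dn (i,j), rt (i,j+1), dn (i+1,j+1), rt (i+1,j+2), ...]
   propagates itself down to the right until it leaves the square. *)
Lemma ray_dn a b f i j : matching f -> covers a b f ->
  sq a b (i + 1) (j + 1) -> dn f i j -> rt f i (j + 1) -> dn f (i + 1) (j + 1).
Proof.
move=> [H V X] C s d r; case/or4P: (C _ _ s) => //; rewrite /up /dn /lf /rt in d r * => h.
(* The cell (i+1,j+1) lies in the dimer of [d], which excludes [up] and [lf]; the cell (i+1,j+2)
   lies in that of [r], which excludes [rt]. *)
- by case: (H _ _ _ _ d h).
- by case: (X (i + 1)%Z j (i + 1)%Z (j + 1)%Z _ _ d h); lia.
- by case: (V _ _ _ _ r h).
Qed.

Lemma ray_rt a b f i j : matching f -> covers a b f ->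
  sq a b (i + 1) (j + 1) -> rt f i j -> dn f (i + 1) j -> rt f (i + 1) (j + 1).
Proof.
move=> /matching_tr m /covers_tr C s r d.
by apply: (@ray_dn a b (tr f) j i) => //; unfold sq in *; lia.
Qed.

(** The [rt] half of a step is one column ahead of the [dn] half, so it may already be outside the
    square; hence the guard on the second conclusion. *)
Lemma stairs a b f i j (t : nat) : matching f -> covers a b f ->
  (a <= i)%Z -> (a <= j)%Z -> dn f i j -> rt f i (j + 1) ->
  (i + Z.of_nat t <= b)%Z -> (j + Z.of_nat t <= b)%Z ->
  dn f (i + Z.of_nat t) (j + Z.of_nat t) /\
  ((j + Z.of_nat t + 1 <= b)%Z -> rt f (i + Z.of_nat t) (j + Z.of_nat t + 1)).
Proof.
move=> m C ai aj d r.
elim: t => [|t IH] hi hj; first by rewrite !Z.add_0_r.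
have [|| d1 r1] := IH; try lia.
have -> : (i + Z.of_nat t.+1 = i + Z.of_nat t + 1)%Z by lia.
have -> : (j + Z.of_nat t.+1 = j + Z.of_nat t + 1)%Z by lia.
have {}r1 := r1 ltac:(lia).
have d2 : dn f (i + Z.of_nat t + 1) (j + Z.of_nat t + 1).
  by apply: (ray_dn m C) => //; unfold sq; lia.
split=> // hj'; apply: (ray_rt m C) => //; unfold sq; lia.
Qed.

(** Row and column grow together, so column b is reached by [rt] in row a + (b - x - 1); one more
    use of the ray lemma gives the [dn] below it. *)
Lemma landing a b f x : matching f -> covers a b f -> (a <= x)%Z -> (x + 1 <= b)%Z ->
  dn f a x -> rt f a (x + 1) -> rt f (a + b - x - 1) b /\ dn f (a + b - x) b.
Proof.
move=> m C ax xb d r; set t := Z.to_nat (b - x - 1).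
have [||d1 r1] := stairs (t := t) m C (Z.le_refl a) ax d r; try lia.
have {}r1 : rt f (a + b - x - 1) b.
  by move: (r1 ltac:(lia)); congr (is_true (rt _ _ _)); lia.
split=> //.
have d2 : dn f (a + b - x - 1) (b - 1) by move: d1; congr (is_true (dn _ _ _)); lia.
have: dn f (a + b - x - 1 + 1) (b - 1 + 1).
  apply: (ray_dn m C) => //; first by unfold sq; lia.
  by move: r1; congr (is_true (rt _ _ _)); lia.
by congr (is_true (dn _ _ _)); lia.
Qed.

Arguments Z.of_nat : simpl never.
Notation "a +z n" := (Z.add a (Z.of_nat n)) (at level 50, left associativity).

(* [ray_in] and [ray_out]: a ray starting, resp. ending, between the points q and
   q + 1 of the top side and heading right; the other rays are seen after
   applying a symmetry of the square. *)
Definition ray_in a f q := dn f a (a +z q) && rt f a (a +z q.+1).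
Definition ray_out a f q := up f a (a +z q) && rt f a (a +z q.+1).
(** With these weights two neighbouring points total 2, unless a vertical direction meets a sideways
    one that is not shared: [dn] then gives 1, the start of a ray, and [up] gives 3, the end of
    one. *)
Definition side_deg a f q : nat :=
  2 * up f a (a +z q) + lf f a (a +z q) + rt f a (a +z q).

(** The sum runs over the gaps between consecutive points because rays live in gaps; the two end
    points are counted once and all the others twice. *)
Definition pairs (g : nat -> nat) K := \sum_(q < K) (g q + g q.+1).
Definition rays_in a K f := \sum_(q < K) ray_in a f q.
Definition rays_out a K f := \sum_(q < K) ray_out a f q.

(* The number of cells covered by dimers when a tiling has M x M interior points,
   so the task is to decide when the weight is M * M + M. *)
Definition weight a M f :=
  2 * (\sum_(p < M.+1) \sum_(q < M) eh f (a +z p) (a +z q)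
     + \sum_(p < M) \sum_(q < M.+1) ev f (a +z p) (a +z q)).

Definition deg f i j : nat := up f i j + dn f i j + lf f i j + rt f i j.

Lemma pairsE g K : pairs g K + g 0 + g K = 2 * \sum_(q < K.+1) g q.
Proof.
have h1 : \sum_(q < K.+1) g q = \sum_(q < K) g q + g K by rewrite big_ord_recr.
have h2 : \sum_(q < K.+1) g q = g 0 + \sum_(q < K) g q.+1 by rewrite big_ord_recl.
rewrite /pairs big_split; move: h1 h2 => /=; lia.
Qed.

Lemma pairs_rev g K : pairs (fun q => g (K - q)) K = pairs g K.
Proof.
rewrite /pairs (reindex_inj rev_ord_inj) /=; apply: eq_bigr => i _.
have := ltn_ord i => h; rewrite addnC; do 2!f_equal; lia.
Qed.

(** * Counting along concentric rings *)

(** Every dimer of the ring is counted four times on either side. An outward dimer has weight 2 and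
    a sideways one is seen from two points, both doubled by [pairs]; the corner terms make up for
    the corner points, which [pairs] counts only once. *)
Lemma ring_sums (H V : nat -> nat -> nat) L :
  let gT q := 2 * H 0 q + V 0 q + V 0 q.+1 in
  let gB q := 2 * H L.+2 q + V L.+1 q + V L.+1 q.+1 in
  let gL q := 2 * V q 0 + H q 0 + H q.+1 0 in
  let gR q := 2 * V q L.+2 + H q L.+1 + H q.+1 L.+1 in
  2 * (2 * (\sum_(p < L.+3) \sum_(q < L.+2) H p q
          + \sum_(p < L.+2) \sum_(q < L.+3) V p q)) =
  2 * (2 * (\sum_(p < L.+1) \sum_(q < L) H p.+1 q.+1
          + \sum_(p < L) \sum_(q < L.+1) V p.+1 q.+1))
  + (pairs gT L.+1 + pairs gR L.+1 + pairs gB L.+1 + pairs gL L.+1)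
  + ((H 0 0 + H 1 0 + V 0 0 + V 0 1)
   + (H 0 L.+1 + H 1 L.+1 + V 0 L.+1 + V 0 L.+2)
   + (H L.+1 0 + H L.+2 0 + V L.+1 0 + V L.+1 1)
   + (H L.+1 L.+1 + H L.+2 L.+1 + V L.+1 L.+1 + V L.+1 L.+2)).
Proof.
move=> gT gB gL gR.
have eT := pairsE gT L.+1; have eB := pairsE gB L.+1.
have eL := pairsE gL L.+1; have eR := pairsE gR L.+1.
have sh (F : nat -> nat) K : \sum_(q < K.+1) F q = F 0 + \sum_(q < K) F q.+1.
  by rewrite big_ord_recl.
have tl (F : nat -> nat) K : \sum_(q < K.+1) F q = \sum_(q < K) F q + F K.
  by rewrite big_ord_recr.
have sp (F : nat -> nat -> nat) K K' :
    \sum_(p < K.+2) \sum_(q < K'.+2) F p q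
    = \sum_(q < K'.+2) F 0 q + \sum_(q < K'.+2) F K.+1 q
    + \sum_(p < K) F p.+1 0 + \sum_(p < K) F p.+1 K'.+1
    + \sum_(p < K) \sum_(q < K') F p.+1 q.+1.
  rewrite (sh (fun p => \sum_(q < K'.+2) F p q)) (tl (fun p => \sum_(q < K'.+2) F p.+1 q)).
  rewrite (eq_bigr (fun p : 'I_K => F p.+1 0 + \sum_(q < K') F p.+1 q.+1 + F p.+1 K'.+1)).
    by rewrite !big_split /=; lia.
  by move=> p _; rewrite (sh (F p.+1)) (tl (fun q => F p.+1 q.+1)); lia.
have ds (A B C : nat -> nat) K : \sum_(q < K) (2 * A q + B q + C q)
    = 2 * \sum_(q < K) A q + \sum_(q < K) B q + \sum_(q < K) C q.
  by rewrite big_distrr -!big_split.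
rewrite (ds (H 0) (V 0) (fun q => V 0 q.+1)) in eT.
rewrite (ds (H L.+2) (V L.+1) (fun q => V L.+1 q.+1)) in eB.
rewrite (ds (fun q => V q 0) (fun q => H q 0) (fun q => H q.+1 0)) in eL.
rewrite (ds (fun q => V q L.+2) (fun q => H q L.+1) (fun q => H q.+1 L.+1)) in eR.
have sh2 (F : nat -> nat) K :
    \sum_(q < K.+2) F q = F 0 + \sum_(q < K) F q.+1 + F K.+1.
  by rewrite (sh F) (tl (fun q => F q.+1)) addnA.
have a1 := sh2 (H 0) L; have a2 := sh2 (H L.+2) L.
have a3 := sh2 (fun q => V q 0) L; have a4 := sh2 (fun q => V q L.+2) L.
have b1 := sh (V 0) L.+2; have b2 := sh (V L.+1) L.+2.
have b3 := tl (V 0) L.+2; have b4 := tl (V L.+1) L.+2.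
have c1 := sh (fun q => H q 0) L.+2; have c2 := sh (fun q => H q L.+1) L.+2.
have c3 := tl (fun q => H q 0) L.+2; have c4 := tl (fun q => H q L.+1) L.+2.
have d1 := sh2 (V 0) L.+1; have d2 := sh2 (V L.+1) L.+1.
have d3 := sh2 (fun q => H q 0) L.+1; have d4 := sh2 (fun q => H q L.+1) L.+1.
(* All sums are now split at their ends into the same shifted pieces, so the identity is linear in
   them. *)
rewrite !sp; move: eT eB eL eR a1 a2 a3 a4 b1 b2 b3 b4 c1 c2 c3 c4 d1 d2 d3 d4.
rewrite /gT /gB /gL /gR /=.
lia.
Qed.

Lemma perp f i j : matching f ->
  [/\ up f i j -> lf f i j = false, up f i j -> rt f i j = false,
      dn f i j -> lf f i j = false & dn f i j -> rt f i j = false].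
Proof.
by case=> _ _ X; split=> h; apply/negP => h'; apply: (X _ _ _ _ _ _ h h'); lia.
Qed.

Lemma facing f i j j' : matching f -> (j' = j + 1)%Z ->
  [/\ up f i j -> up f i j' = false, dn f i j -> dn f i j' = false,
      lf f j i -> lf f j' i = false & rt f j i -> rt f j' i = false].
Proof.
by case=> H V _ e; split=> h; apply/negP => h'; [apply: H h h'|apply: H h h'|apply: V h h'|apply: V h h'].
Qed.

Lemma rt_lf f i j j' : (j' = j + 1)%Z -> lf f i j' = rt f i j.
Proof. by move=> ->. Qed.
Lemma dn_up f i i' j : (i' = i + 1)%Z -> up f i' j = dn f i j.
Proof. by move=> ->. Qed.

(* The two sides differ only when some point is covered twice. *)
Lemma pair_bits (u d l r u' d' l' r' : bool) :
  (u -> l = false) -> (u -> r = false) -> (d -> l = false) -> (d -> r = false) ->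
  (u' -> l' = false) -> (u' -> r' = false) -> (d' -> l' = false) -> (d' -> r' = false) ->
  (u -> u' = false) -> (d -> d' = false) -> l' = r ->
  [|| u, d, l | r] -> [|| u', d', l' | r'] ->
  2 + (u && r') + (u' && l) + (u && d) + (u' && d')
    <= (2 * u + l + r) + (2 * u' + l' + r') + (d && r') + (d' && l)
  /\ (u + d + l + r = 1 -> u' + d' + l' + r' = 1 ->
  2 + (u && r') + (u' && l) = (2 * u + l + r) + (2 * u' + l' + r') + (d && r') + (d' && l)).
Proof.
case: u; case: d; case: l; case: r; case: u'; case: d'; case: l'; case: r' => //=;
  intuition congruence.
Qed.

Section Ring.
Variables (a : Z) (K : nat) (f : field).
Let b := (a +z K)%Z.
Let c := (a + b)%Z.
Hypotheses (m : matching f) (C : covers a b f).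

(** In the mirrored field the gap q has index K - 1 - q, so this accounts for the rays through one
    gap in both directions. The equality is the version for points covered exactly once. *)
Lemma pair_bound q : q < K ->
  2 + ray_out a f q + ray_out a (hflip c f) (K.-1 - q)
    + (up f a (a +z q) && dn f a (a +z q)) + (up f a (a +z q.+1) && dn f a (a +z q.+1))
  <= side_deg a f q + side_deg a f q.+1 + ray_in a f q + ray_in a (hflip c f) (K.-1 - q)
  /\ (deg f a (a +z q) = 1 -> deg f a (a +z q.+1) = 1 ->
  2 + ray_out a f q + ray_out a (hflip c f) (K.-1 - q)
  = side_deg a f q + side_deg a f q.+1 + ray_in a f q + ray_in a (hflip c f) (K.-1 - q)).
Proof.
move=> hq.
have e1 : (c - (a +z (K.-1 - q)) = a +z q.+1)%Z by rewrite /c /b; lia.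
have e2 : (c - (a +z (K.-1 - q).+1) = a +z q)%Z by rewrite /c /b; lia.
rewrite /ray_out /ray_in /side_deg !accE e1 e2.
have e : (a +z q.+1 = a +z q + 1)%Z by lia.
have [p1 p2 p3 p4] := perp a (a +z q) m.
have [p5 p6 p7 p8] := perp a (a +z q.+1) m.
have [f1 f2 _ _] := facing a m e.
have hc : [|| up f a (a +z q), dn f a (a +z q), lf f a (a +z q) | rt f a (a +z q)].
  by apply: C; rewrite /sq /b; lia.
have hc' : [|| up f a (a +z q.+1), dn f a (a +z q.+1), lf f a (a +z q.+1) | rt f a (a +z q.+1)].
  by apply: C; rewrite /sq /b; lia.
exact: pair_bits (rt_lf f a e) hc hc'.
Qed.

(** By [landing] a ray from gap q of the top ends at gap K - 1 - q of the right side, counted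
    downwards; [turn] makes the right side the top one, with rows becoming columns in the same
    order. *)
Lemma ray_in_out q : q < K -> ray_in a f q -> ray_out a (turn c f) (K.-1 - q).
Proof.
move=> hq /andP[d r].
have [|||r1 d1] := landing (x := (a +z q)%Z) m C _ _ d.
- lia.
- rewrite /b; lia.
- by move: r; congr (is_true (rt _ _ _)); lia.
rewrite /ray_out !accE; apply/andP; split.
- by move: r1; congr (is_true (rt _ _ _)); rewrite /b /c; lia.
- by move: d1; congr (is_true (dn _ _ _)); rewrite /b /c; lia.
Qed.

End Ring.

Lemma rays_in_rev a K f : \sum_(q < K) ray_in a f (K.-1 - q) = rays_in a K f.
Proof.
rewrite /rays_in (reindex_inj rev_ord_inj) /=; apply: eq_bigr => i _.
by have h := ltn_ord i; congr (nat_of_bool (ray_in _ _ _)); lia.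
Qed.

Lemma rays_out_rev a K f : \sum_(q < K) ray_out a f (K.-1 - q) = rays_out a K f.
Proof.
rewrite /rays_out (reindex_inj rev_ord_inj) /=; apply: eq_bigr => i _.
by have h := ltn_ord i; congr (nat_of_bool (ray_out _ _ _)); lia.
Qed.

Definition doubles a K f := \sum_(q < K) (up f a (a +z q) && dn f a (a +z q)
  + (up f a (a +z q.+1) && dn f a (a +z q.+1))).

Lemma side_bound a K f (c := (a + (a +z K))%Z) : matching f -> covers a (a +z K) f ->
  2 * K + rays_out a K f + rays_out a K (hflip c f) + doubles a K f
  <= pairs (side_deg a f) K + rays_in a K f + rays_in a K (hflip c f).
Proof.
move=> m C; rewrite -(rays_out_rev a K (hflip c f)) -(rays_in_rev a K (hflip c f)) mulnC.
rewrite -[X in X * 2]card_ord -sum_nat_const -!big_split /=; apply: leq_sum => q _.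
by have [h _] := pair_bound m C (ltn_ord q); move: h; rewrite /c; lia.
Qed.

Lemma side_eq a K f (c := (a + (a +z K))%Z) : matching f -> covers a (a +z K) f ->
  (forall q, q <= K -> deg f a (a +z q) = 1) ->
  2 * K + rays_out a K f + rays_out a K (hflip c f)
  = pairs (side_deg a f) K + rays_in a K f + rays_in a K (hflip c f).
Proof.
move=> m C D; rewrite -(rays_out_rev a K (hflip c f)) -(rays_in_rev a K (hflip c f)) mulnC.
rewrite -[X in X * 2]card_ord -sum_nat_const -!big_split /=; apply: eq_bigr => q _.
have hq := ltn_ord q.
have [_ h] := pair_bound m C hq.
by have := h (D _ (ltnW hq)) (D _ hq); rewrite /c; lia.
Qed.

Lemma land_bound a K f (c := (a + (a +z K))%Z) : matching f -> covers a (a +z K) f ->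
  rays_in a K f <= rays_out a K (turn c f).
Proof.
move=> m C; rewrite -rays_out_rev; apply: leq_sum => q _.
by case E: (ray_in a f q) => //; rewrite (ray_in_out m C (ltn_ord q) E).
Qed.

(** [ray_in] implies [ray_out] gap by gap, so equal totals turn every one of these implications into
    an equivalence. *)
Lemma land_converse a K f (c := (a + (a +z K))%Z) : matching f -> covers a (a +z K) f ->
  rays_in a K f = rays_out a K (turn c f) ->
  forall q, q < K -> ray_out a (turn c f) (K.-1 - q) -> ray_in a f q.
Proof.
move=> m C e q hq ho; apply/negPn/negP => hi.
suff: rays_in a K f < rays_out a K (turn c f) by lia.
rewrite -rays_out_rev /rays_in (bigD1 (Ordinal hq)) // [X in _ < X](bigD1 (Ordinal hq)) //=.
rewrite (negbTE hi) ho add0n add1n ltnS; apply: leq_sum => p _.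
by case E: (ray_in a f p) => //; rewrite (ray_in_out m C (ltn_ord p) E).
Qed.

Lemma weight_ring a L f (c := (a + (a +z L.+1))%Z) :
  let g1 := turn c f in let g2 := turn c g1 in let g3 := turn c g2 in
  2 * weight a L.+2 f = 2 * weight (a + 1) L f
  + (pairs (side_deg a f) L.+1 + pairs (side_deg a g1) L.+1
     + pairs (side_deg a g2) L.+1 + pairs (side_deg a g3) L.+1)
  + (deg f a a + deg f a (a +z L.+1) + deg f (a +z L.+1) a + deg f (a +z L.+1) (a +z L.+1)).
Proof.
move=> g1 g2 g3.
pose H (p q : nat) : nat := eh f (a +z p) (a +z q).
pose V (p q : nat) : nat := ev f (a +z p) (a +z q).
have eqS (F G : nat -> nat) k : (forall q, q < k -> F q = G q) ->
    \sum_(q < k) F q = \sum_(q < k) G q.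
  by move=> h; apply: eq_bigr => i _; apply: h.
have eqP (F G : nat -> nat) k : (forall q, q <= k -> F q = G q) -> pairs F k = pairs G k.
  move=> h; apply: (eqS (fun q => F q + F q.+1) (fun q => G q + G q.+1)) => q hq.
  by rewrite !h // ltnW.
have eE i j i' j' : i = i' -> j = j' -> eh f i j = eh f i' j' by move=> -> ->.
have eV i j i' j' : i = i' -> j = j' -> ev f i j = ev f i' j' by move=> -> ->.
have := ring_sums H V L; cbv zeta.
rewrite -(eqP (side_deg a f)); last first.
  move=> q hq; rewrite /side_deg /H /V /up /lf /rt.
  by congr (2 * nat_of_bool _ + nat_of_bool _ + nat_of_bool _);
    [apply: eE|apply: eV|apply: eV]; lia.
rewrite -(eqP (side_deg a g1) (fun q => 2 * V q L.+2 + H q L.+1 + H q.+1 L.+1)); last first.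
  move=> q hq; rewrite /side_deg /g1 /turn !accE /H /V /up /lf /rt /dn.
  by congr (2 * nat_of_bool _ + nat_of_bool _ + nat_of_bool _);
    [apply: eV|apply: eE|apply: eE]; rewrite /c; lia.
(* After two and three turns the bottom and the left side are run through backwards. *)
rewrite -(pairs_rev (fun q => 2 * H L.+2 q + V L.+1 q + V L.+1 q.+1)).
rewrite -(eqP (side_deg a g2) (fun q => 2 * H L.+2 (L.+1 - q) + V L.+1 (L.+1 - q) + V L.+1 (L.+1 - q).+1)); last first.
  move=> q hq; rewrite /side_deg /g2 /g1 /turn !accE /H /V /up /lf /rt /dn.
  rewrite -addnA [X in _ + X]addnC addnA.
  by congr (2 * nat_of_bool _ + nat_of_bool _ + nat_of_bool _);
    [apply: eE|apply: eV|apply: eV]; rewrite /c; lia.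
rewrite -(pairs_rev (fun q => 2 * V q 0 + H q 0 + H q.+1 0)).
rewrite -(eqP (side_deg a g3) (fun q => 2 * V (L.+1 - q) 0 + H (L.+1 - q) 0 + H (L.+1 - q).+1 0)); last first.
  move=> q hq; rewrite /side_deg /g3 /g2 /g1 /turn !accE /H /V /up /lf /rt /dn.
  rewrite -addnA [X in _ + X]addnC addnA.
  by congr (2 * nat_of_bool _ + nat_of_bool _ + nat_of_bool _);
    [apply: eV|apply: eE|apply: eE]; rewrite /c; lia.
have -> : 2 * (\sum_(p < L.+1) \sum_(q < L) H p.+1 q.+1
    + \sum_(p < L) \sum_(q < L.+1) V p.+1 q.+1) = weight (a + 1) L f.
  rewrite /weight; congr (2 * (_ + _)); apply: eq_bigr => p _; apply: eq_bigr => q _;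
    rewrite /H /V; congr nat_of_bool; [apply: eE|apply: eV]; lia.
have dE i j p q : i = (a +z p)%Z -> j = (a +z q)%Z ->
    deg f i j = H p q + H p.+1 q + V p q + V p q.+1.
  move=> -> ->; rewrite /deg /H /V /up /dn /lf /rt.
  by congr (nat_of_bool _ + nat_of_bool _ + nat_of_bool _ + nat_of_bool _);
    [apply: eE|apply: eV]; lia.
rewrite (dE a a 0 0) ?(dE a _ 0 L.+1) ?(dE _ a L.+1 0) ?(dE _ _ L.+1 L.+1) //; lia.
Qed.

Lemma deg_hflip c f i j : deg (hflip c f) i j = deg f i (c - j).
Proof. by rewrite /deg !accE -!addnA [X in _ + (_ + X)]addnC. Qed.

Lemma deg_turn c f i j : deg (turn c f) i j = deg f j (c - i).
Proof.
rewrite /deg /turn !accE; lia.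
Qed.

Lemma covers_deg a b f i j : covers a b f -> sq a b i j -> 0 < deg f i j.
Proof. by move=> C s; have := C i j s; rewrite /deg; case/or4P => ->; lia. Qed.

(* Summed over the four sides, the rays which start on a side cancel against the
   rays which end on the next one. *)
Lemma ring_bound a L f (c := (a + (a +z L.+1))%Z) :
  matching f -> covers a (a +z L.+1) f ->
  2 * weight (a + 1) L f + 8 * L.+1 + 4 + rays_out a L.+1 (turn c f) + doubles a L.+1 f
  <= 2 * weight a L.+2 f + rays_in a L.+1 f.
Proof.
move=> m C.
have := weight_ring a L f; cbv zeta.
rewrite -/c.
set g1 := turn c f; set g2 := turn c g1; set g3 := turn c g2.
have m1 : matching g1 by apply: matching_turn.
have m2 : matching g2 by apply: matching_turn.
have m3 : matching g3 by apply: matching_turn.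
have C1 : covers a (a +z L.+1) g1 by apply: covers_turn.
have C2 : covers a (a +z L.+1) g2 by apply: covers_turn.
have C3 : covers a (a +z L.+1) g3 by apply: covers_turn.
have s0 := side_bound m C; have s1 := side_bound m1 C1.
have s2 := side_bound m2 C2; have s3 := side_bound m3 C3.
have l0 := land_bound m C; have l1 := land_bound m1 C1.
have l2 := land_bound m2 C2; have l3 := land_bound m3 C3.
have k0 := land_bound (matching_hflip c m) (covers_hflip C).
have k1 := land_bound (matching_hflip c m1) (covers_hflip C1).
have k2 := land_bound (matching_hflip c m2) (covers_hflip C2).
have k3 := land_bound (matching_hflip c m3) (covers_hflip C3).
rewrite -/c -?/g1 -?/g2 -?/g3 in s0 s1 s2 s3 l0 l1 l2 l3 k0 k1 k2 k3.
rewrite [turn c g3]turn4 in l3.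
rewrite {2}(_ : f = turn c g3) ?turn_hflip in k0; last by rewrite /g3 /g2 /g1 turn4.
rewrite {2}/g1 turn_hflip in k1; rewrite {2}/g2 turn_hflip in k2; rewrite {2}/g3 turn_hflip in k3.
have d1 : 0 < deg f a a by apply: covers_deg C _; unfold sq; lia.
have d2 : 0 < deg f a (a +z L.+1) by apply: covers_deg C _; unfold sq; lia.
have d3 : 0 < deg f (a +z L.+1) a by apply: covers_deg C _; unfold sq; lia.
have d4 : 0 < deg f (a +z L.+1) (a +z L.+1) by apply: covers_deg C _; unfold sq; lia.
(* The constant is 2 * L.+1 for each of four sides plus one for each corner. All landing
   inequalities but [l0] are added up; the slack of [l0] and the double points of one side stay in
   the conclusion, for use in the case of equality. *)
move=> e; lia.
Qed.

(** Removing a ring lowers M by 2, and M(M+1) - (M-2)(M-1) = 4M - 2 is half of the constant 8 * L.+1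
    + 4 in [ring_bound]. The rays of the ring cancel by [land_bound]. *)
Theorem weight_bound M : forall a f, matching f -> covers a (a +z M - 1) f ->
  M * M + M <= weight a M f.
Proof.
elim/ltn_ind: M => -[|[|L]] IH a f m C.
- by [].
- rewrite /weight !big_ord_recl !big_ord0 /=.
  have := @covers_deg _ _ f a a C; rewrite /deg /up /dn /lf /rt.
  rewrite !Z.add_0_r /= => h.
  have e : (a +z 1 = a + 1)%Z by lia.
  have {}h := h ltac:(unfold sq; lia).
  move: h; change (Z.of_nat (bump 0 0)) with 1%Z; lia.
have eb : (a +z L.+2 - 1 = a +z L.+1)%Z by lia.
rewrite eb in C.
have := ring_bound m C; have := land_bound m C.
have h := IH L (ltac:(lia)) (a + 1)%Z f m.
have {}h := h ltac:(by apply: covers_sub C; lia).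
lia.
Qed.

Lemma weight_tr a M f : weight a M (tr f) = weight a M f.
Proof.
rewrite /weight /=; congr (2 * _); rewrite addnC.
by congr addn; rewrite exchange_big.
Qed.

Lemma weight_hflip a M f : weight a M (hflip (a + (a +z M - 1)) f) = weight a M f.
Proof.
rewrite /weight /=; congr (2 * (_ + _)); apply: eq_bigr => p _;
  rewrite (reindex_inj rev_ord_inj) /=; apply: eq_bigr => q _; have h := ltn_ord q.
- by congr (nat_of_bool (eh _ _ _)); lia.
- by congr (nat_of_bool (ev _ _ _)); lia.
Qed.

(** * The extremal fields *)

(** The conclusion is the step which precedes [dn (i,j)] in the staircase: a ray met below the top
    row has a predecessor. *)
Definition back a b f := forall i j, sq a b i j -> sq a b i (j + 1) -> (a < i)%Z ->
  dn f i j -> rt f i (j + 1) -> rt f (i - 1) j.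

(* [g_back] says, up to the symmetries of the square, that no ray starts inside
   the square. *)
Record good a b f : Prop := Good {
  g_m : matching f;
  g_c : covers a b f;
  g_deg : forall i j, sq a b i j -> deg f i j = 1;
  g_back : forall k, back a b (iter k (turn (a + b)) f) /\
                     back a b (hflip (a + b) (iter k (turn (a + b)) f)) }.

(** The dihedral relation: conjugation by a reflection inverts the turn, and the inverse of a turn
    is its cube. *)
Lemma iter_turn_hflip c k f : iter k (turn c) (hflip c f) = hflip c (iter (3 * k) (turn c) f).
Proof.
elim: k => [|k IH] //; rewrite iterS IH mulnS addSn addSn addSn add0n !iterS.
set g := iter (3 * k) _ _.
by rewrite -[in LHS](turn4 c g) turn_hflip.
Qed.

Lemma good_turn a b f : good a b f -> good a b (turn (a + b) f).
Proof.
case=> m C D B; split.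
- exact: matching_turn.
- exact: covers_turn.
- by move=> i j s; rewrite deg_turn D //; unfold sq in *; lia.
- by move=> k; rewrite -iterSr.
Qed.

Lemma good_hflip a b f : good a b f -> good a b (hflip (a + b) f).
Proof.
case=> m C D B; split.
- exact: matching_hflip.
- exact: covers_hflip.
- by move=> i j s; rewrite deg_hflip D //; unfold sq in *; lia.
- by move=> k; rewrite iter_turn_hflip hflipK; have [? ?] := B (3 * k).
Qed.

Lemma good_tr a b f : good a b f -> good a b (tr f).
Proof. by move=> /good_hflip/good_turn; rewrite /turn hflipK. Qed.

Definition landing_converse a K f := forall q, q < K ->
  ray_out a (turn (a + (a +z K)) f) (K.-1 - q) -> ray_in a f q.

(** The ray is followed forwards to its exit from the square. The converse of landing produces a ray
    starting on the border with this exit; run forwards again, it stays on the same two diagonals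
    and passes through the point (i-1,j). *)
Lemma back_of_conv a K f : matching f -> covers a (a +z K) f ->
  landing_converse a K f -> landing_converse a K (tr f) -> back a (a +z K) f.
Proof.
have [b eb] : exists b, b = (a +z K)%Z by eexists.
rewrite /landing_converse -eb => m C cv cvt i j si sj ai d r.
have lift g :
    (forall q, q < K -> ray_out a (turn (a + b) g) (K.-1 - q) -> ray_in a g q) -> forall y, (a <= y)%Z -> (y + 1 <= b)%Z ->
    rt g y b -> dn g (y + 1) b ->
    dn g a (a + b - 1 - y) /\ rt g a (a + b - 1 - y + 1).
  move=> cg y ay yb r1 d1.
  have := cg (Z.to_nat (b - 1 - y)); rewrite /ray_in /ray_out /turn !accE => h.
  have /andP[d2 r2] : dn g a (a +z Z.to_nat (b - 1 - y))
      && rt g a (a +z (Z.to_nat (b - 1 - y)).+1).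
    apply: h; first by lia.
    by apply/andP; split; [move: r1; congr (is_true (rt _ _ _))|
      move: d1; congr (is_true (dn _ _ _))]; lia.
  by split; [move: d2; congr (is_true (dn _ _ _))|move: r2; congr (is_true (rt _ _ _))]; lia.
(* On or above the diagonal the exit is on the right side; below it, on the bottom, which is the
   right side of the transposed field. *)
have [ij|ij] : (i <= j \/ j < i)%Z by lia.
- have [||||d1 r1] := stairs (t := Z.to_nat (b - 1 - j)) m C _ _ d r; try by unfold sq in *; lia.
  have e : (j +z Z.to_nat (b - 1 - j) = b - 1)%Z by unfold sq in *; lia.
  have e' : (i +z Z.to_nat (b - 1 - j) = i + b - 1 - j)%Z by unfold sq in *; lia.
  rewrite e e' in d1 r1.
  have {}r1 : rt f (i + b - 1 - j) b.
    by move: (r1 ltac:(lia)); congr (is_true (rt _ _ _)); lia.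
  have d2 : dn f (i + b - 1 - j + 1) b.
    have : dn f (i + b - 1 - j + 1) (b - 1 + 1).
      apply: (ray_dn m C) => //; first by unfold sq in *; lia.
      by move: r1; congr (is_true (rt _ _ _)); lia.
    by congr (is_true (dn _ _ _)); lia.
  have [||d3 r3] := lift f cv _ _ _ r1 d2; try by unfold sq in *; lia.
  have [||||_] := stairs (t := Z.to_nat (i - 1 - a)) m C _ _ d3 r3; try by unfold sq in *; lia.
  move=> h; move: (h ltac:(unfold sq in *; lia)); congr (is_true (rt _ _ _)); unfold sq in *; lia.
- have [||||d1 r1] := stairs (t := Z.to_nat (b - i)) m C _ _ d r; try by unfold sq in *; lia.
  have e : (i +z Z.to_nat (b - i) = b)%Z by unfold sq in *; lia.
  have e' : (j +z Z.to_nat (b - i) = j + b - i)%Z by unfold sq in *; lia.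
  rewrite e e' in d1 r1.
  have {}r1 := r1 ltac:(lia).
  have [||d3 r3] := lift (tr f) cvt (j + b - i)%Z _ _ d1 r1; try by unfold sq in *; lia.
  have [||||h _] := stairs (t := Z.to_nat (j - a)) (matching_tr m) (covers_tr C) _ _ d3 r3;
    try by unfold sq in *; lia.
  move: h; rewrite accE; congr (is_true (rt _ _ _)); unfold sq in *; lia.
Qed.

Lemma deg1E f i j : matching f ->
  ~~ (up f i j && dn f i j) -> ~~ (lf f i j && rt f i j) -> 0 < deg f i j ->
  deg f i j = 1.
Proof.
move=> m; have [p1 p2 p3 p4] := perp i j m; move: p1 p2 p3 p4; rewrite /deg.
by case: (up f i j); case: (dn f i j); case: (lf f i j); case: (rt f i j) => //=;
  intuition congruence.
Qed.

Definition topfree a b f := forall j, (a <= j <= b)%Z -> ~~ (up f a j && dn f a j).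

(** If (i,j) is covered from above and below, both cells between (i,j) and (i,j+1) are taken, so
    (i,j+1) can only be [rt]. This makes a ray, whose predecessor [rt (i-1,j)] would overlap the
    dimer above (i,j). *)
Lemma no_double a b f i j : matching f -> covers a b f -> back a b f -> topfree a b f ->
  sq a b i j -> (j < b)%Z -> ~~ (up f i j && dn f i j).
Proof.
move=> m C B T s jb; apply/negP => /andP[u d].
have [e|ai] : (i = a \/ a < i)%Z by unfold sq in *; lia.
  by have := T j ltac:(unfold sq in *; lia); rewrite -e u d.
have s' : sq a b i (j + 1) by unfold sq in *; lia.
have r : rt f i (j + 1).
  have [f1 _ _ _] := facing i m (erefl (j + 1)%Z).
  have [_ f2 _ _] := facing i m (erefl (j + 1)%Z).
  case/or4P: (C _ _ s') => //; rewrite ?f1 ?f2 // => h.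
  by case: m => _ _ X; case: (X i j i (j + 1)%Z _ _ u h); lia.
have h := B _ _ s s' ai d r.
by case: m => _ _ X; case: (X (i - 1)%Z j i (j + 1)%Z _ _ u h); lia.
Qed.

Section Equality.
Variables (a : Z) (L : nat).
Let K := L.+1.
Let b := (a +z K)%Z.
Let c := (a + b)%Z.

Let tight f := [/\ matching f, covers a b f & weight a K.+1 f = K.+1 * K.+1 + K.+1].

Let e_c : (a + (a +z K.+1 - 1))%Z = c.
Proof. rewrite /c /b; lia. Qed.

Lemma tight_tr f : tight f -> tight (tr f).
Proof. by case=> m C e; split; [apply: matching_tr|apply: covers_tr|rewrite weight_tr]. Qed.

Lemma tight_hflip f : tight f -> tight (hflip c f).
Proof.
by case=> m C e; split; [apply: matching_hflip|apply: covers_hflip|rewrite -e_c weight_hflip].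
Qed.

(** With the bound for the inner square, equality leaves no slack in [ring_bound]. Only one side is
    inspected; [tight] is stable under the reflections, which bring the other sides to the top. *)
Lemma tight_conv f : tight f -> landing_converse a K f /\ topfree a b f.
Proof.
case=> m C e.
have h := ring_bound m C; have h1 := land_bound m C.
have := @weight_bound L (a + 1) f m.
have -> : (a + 1 +z L - 1 = b - 1)%Z by rewrite /b /K; lia.
move=> /(_ ltac:(by apply: covers_sub C; lia)) h2.
have [e1 e2] : rays_in a K f = rays_out a K (turn c f) /\ doubles a K f = 0.
  by move: h h1 h2 e; rewrite -/K /c /b; nia.
split; first exact: land_converse.
have z q : q < K -> ~~ (up f a (a +z q) && dn f a (a +z q))
    /\ ~~ (up f a (a +z q.+1) && dn f a (a +z q.+1)).
  move=> hq; move/eqP: e2; rewrite /doubles sum_nat_eq0 => /forallP /(_ (Ordinal hq)) /=.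
  by rewrite addn_eq0 !eqb0 => /andP.
move=> j hj.
have [jb|jb] : (j < b \/ j = b)%Z by lia.
  have [h3 _] := z (Z.to_nat (j - a)) ltac:(rewrite /b in jb; lia).
  by move: h3; have -> : (a +z Z.to_nat (j - a) = j)%Z by lia.
by have [_] := z L ltac:(rewrite /K; lia); rewrite jb.
Qed.

Lemma tight_back f : tight f -> back a b f.
Proof.
move=> h; have [m C _] := h.
by apply: back_of_conv => //; [case: (tight_conv h)|case: (tight_conv (tight_tr h))].
Qed.

Lemma tight_vdouble f i j : tight f -> sq a b i j -> ~~ (up f i j && dn f i j).
Proof.
move=> h s; have [m C _] := h; have [_ T] := tight_conv h.
have [jb|jb] : (j < b \/ j = b)%Z by unfold sq in *; lia.
  exact: no_double (tight_back h) T s jb.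
have h' := tight_hflip h; have [m' C' _] := h'; have [_ T'] := tight_conv h'.
have := no_double (i := i) (j := (c - j)%Z) m' C' (tight_back h') T'; rewrite !accE.
have -> : (c - (c - j) = j)%Z by lia.
by apply; unfold sq in *; rewrite /c /b /K in jb s *; lia.
Qed.

Lemma tight_good f : matching f -> covers a b f -> weight a K.+1 f = K.+1 * K.+1 + K.+1 ->
  good a b f.
Proof.
move=> m C e; have h : tight f by [].
split=> //.
- move=> i j s; apply: deg1E => //; [exact: tight_vdouble| |exact: covers_deg C s].
  have := tight_vdouble (i := j) (j := i) (tight_tr h); rewrite !accE; apply.
  by unfold sq in *; lia.
- move=> k; have hk : tight (iter k (turn c) f).
    by elim: k => [|k IH] //=; apply/tight_tr/tight_hflip.
  by split; [exact: tight_back|exact/tight_back/tight_hflip].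
Qed.

End Equality.

Ltac sqlia := unfold sq in *; lia.

(** * Rays are full chords *)

Definition vflip c f := tr (hflip c (tr f)).
Lemma up_vflip c f i j : up (vflip c f) i j = dn f (c - i) j. Proof. by rewrite /vflip !accE. Qed.
Lemma dn_vflip c f i j : dn (vflip c f) i j = up f (c - i) j. Proof. by rewrite /vflip !accE. Qed.
Lemma lf_vflip c f i j : lf (vflip c f) i j = lf f (c - i) j. Proof. by rewrite /vflip !accE. Qed.
Lemma rt_vflip c f i j : rt (vflip c f) i j = rt f (c - i) j. Proof. by rewrite /vflip !accE. Qed.
Definition vflipE := (up_vflip, dn_vflip, lf_vflip, rt_vflip).

Lemma good_vflip a b f : good a b f -> good a b (vflip (a + b) f).
Proof. by move=> g; apply/good_tr/good_hflip/good_tr. Qed.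

Lemma good_sub a b f : good a b f -> good (a + 1) (b - 1) f.
Proof.
case=> m C D B; split=> //.
- by apply: covers_sub C; lia.
- by move=> i j s; apply: D; sqlia.
- move=> k; have -> : (a + 1 + (b - 1) = a + b)%Z by lia.
  by have [h1 h2] := B k; split=> i j s s' ai; [apply: h1|apply: h2]; sqlia.
Qed.

Lemma eq_up f i j i' j' : i = i' -> j = j' -> up f i j -> up f i' j'.
Proof. by move=> -> ->. Qed.
Lemma eq_dn f i j i' j' : i = i' -> j = j' -> dn f i j -> dn f i' j'.
Proof. by move=> -> ->. Qed.
Lemma eq_lf f i j i' j' : i = i' -> j = j' -> lf f i j -> lf f i' j'.
Proof. by move=> -> ->. Qed.
Lemma eq_rt f i j i' j' : i = i' -> j = j' -> rt f i j -> rt f i' j'.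
Proof. by move=> -> ->. Qed.

Section Lines.
Variables (a b : Z).

Lemma back_rt f i j : good a b f -> sq a b i j -> sq a b i (j + 1) -> (a < i)%Z ->
  dn f i j -> rt f i (j + 1) -> rt f (i - 1) j.
Proof. by move=> g; have [B _] := g_back g 0; apply: B. Qed.

Lemma back_dn f i j : good a b f -> sq a b i j -> sq a b (i + 1) j -> (a < j)%Z ->
  rt f i j -> dn f (i + 1) j -> dn f i (j - 1).
Proof.
by move=> /good_tr g *; apply: (back_rt (f := tr f) (i := j) (j := i) g) => //; sqlia.
Qed.

Lemma stairs_back f i j (t : nat) : good a b f -> sq a b i j -> sq a b i (j + 1) ->
  dn f i j -> rt f i (j + 1) -> (a <= i - Z.of_nat t)%Z -> (a <= j - Z.of_nat t)%Z ->
  dn f (i - Z.of_nat t) (j - Z.of_nat t) /\ rt f (i - Z.of_nat t) (j - Z.of_nat t + 1).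
Proof.
move=> g s s' d r; elim: t => [|t IH] hi hj; first by rewrite !Z.sub_0_r.
have [||d1 r1] := IH; try lia.
have r2 : rt f (i - Z.of_nat t - 1) (j - Z.of_nat t) by apply: (back_rt g) => //; sqlia.
split; last by apply: eq_rt r2; lia.
have d2 : dn f (i - Z.of_nat t - 1) (j - Z.of_nat t - 1).
  by apply: (back_dn g) => //; try sqlia; apply: eq_dn d1; lia.
by apply: eq_dn d2; lia.
Qed.

(* Forwards by the ray lemma and backwards by [g_back], the staircase runs along
   two complete diagonals of the square. *)
Lemma line_DR f i j : good a b f -> sq a b i j -> sq a b i (j + 1) ->
  dn f i j -> rt f i (j + 1) -> forall i' j', sq a b i' j' ->
  ((j' - i' = j - i)%Z -> dn f i' j') /\ ((j' - i' = j - i + 1)%Z -> rt f i' j').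
Proof.
move=> g s s' d r i' j' s1.
have [ii|ii] : (i <= i' \/ i' < i)%Z by lia.
- have st := stairs (t := Z.to_nat (i' - i)) (g_m g) (g_c g) _ _ d r.
  split=> e.
    by have [||||h _] := st; try sqlia; apply: eq_dn h; lia.
  by have [||||_ h] := st; try sqlia; apply: eq_rt (h _); sqlia.
- split=> e.
    have [||h _] := stairs_back (t := Z.to_nat (i - i')) g s s' d r; try sqlia.
    by apply: eq_dn h; lia.
  have [||d1 r1] := stairs_back (t := Z.to_nat (i - i' - 1)) g s s' d r; try sqlia.
  have := back_rt g _ _ _ d1 r1 => h.
  by apply: eq_rt (h _ _ _); sqlia.
Qed.

Lemma line_UR f i j : good a b f -> sq a b i j -> sq a b i (j + 1) ->
  up f i j -> rt f i (j + 1) -> forall i' j', sq a b i' j' ->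
  ((i' + j' = i + j)%Z -> up f i' j') /\ ((i' + j' = i + j + 1)%Z -> rt f i' j').
Proof.
move=> /good_vflip g s s' u r i' j' s1.
have := line_DR (i := (a + b - i)%Z) (j := j) g _ _ _ _ (i' := (a + b - i')%Z) (j' := j').
rewrite !vflipE; have e k : (a + b - (a + b - k) = k)%Z by lia.
rewrite !e => h; by have [|||||h1 h2] := h; sqlia.
Qed.

Lemma line_RD f i j : good a b f -> sq a b i j -> sq a b (i + 1) j ->
  rt f i j -> dn f (i + 1) j -> forall i' j', sq a b i' j' ->
  ((j' - i' = j - i)%Z -> rt f i' j') /\ ((j' - i' = j - i - 1)%Z -> dn f i' j').
Proof.
move=> /good_tr g s s' r d i' j' s1.
have := line_DR (f := tr f) (i := j) (j := i) g _ _ _ _ (i' := j') (j' := i').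
by rewrite !accE => h; have [|||||h1 h2] := h; sqlia.
Qed.

End Lines.

(** The converse of the equality case: sides, landings and corners of each ring all attain their
    bounds, so the induction of [weight_bound] runs with equalities. *)
Lemma good_weight M : forall a f, good a (a +z M - 1) f -> weight a M f = M * M + M.
Proof.
elim/ltn_ind: M => -[|[|L]] IH a f g.
- by rewrite /weight !big_ord_recl !big_ord0.
- rewrite /weight !big_ord_recl !big_ord0 /=.
  have := g_deg g (i := a) (j := a); rewrite /deg /up /dn /lf /rt.
  rewrite !Z.add_0_r /= => h; have {}h := h ltac:(sqlia).
  move: h; change (Z.of_nat (bump 0 0)) with 1%Z; lia.
have := weight_ring a L f; cbv zeta.
set c := (a + (a +z L.+1))%Z.
have eb : (a +z L.+2 - 1 = a +z L.+1)%Z by lia.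
rewrite eb in g.
have ec : c = (a + (a +z L.+1))%Z by [].
set g1 := turn c f; set g2 := turn c g1; set g3 := turn c g2.
have G1 : good a (a +z L.+1) g1 by apply: good_turn.
have G2 : good a (a +z L.+1) g2 by apply: good_turn.
have G3 : good a (a +z L.+1) g3 by apply: good_turn.
have sE h : good a (a +z L.+1) h -> 2 * L.+1 + rays_out a L.+1 h + rays_out a L.+1 (hflip c h)
    = pairs (side_deg a h) L.+1 + rays_in a L.+1 h + rays_in a L.+1 (hflip c h).
  move=> gh; apply: side_eq; [exact: g_m gh|exact: g_c gh|].
  by move=> q hq; apply: (g_deg gh); sqlia.
(* A ray ending on the right side is a full chord by [line_RD], so it starts on the top side. *)
have lE h : good a (a +z L.+1) h -> rays_in a L.+1 h = rays_out a L.+1 (turn c h).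
  move=> gh; apply/eqP; rewrite eqn_leq land_bound; [|exact: g_m gh|exact: g_c gh].
  rewrite -rays_out_rev /rays_in /=; apply: leq_sum => q _; have hq := ltn_ord q.
  case E: (ray_out _ _ _) => //; move: E; rewrite /ray_out /turn !accE => /andP[r d].
  have e1 : (c - a = a +z L.+1)%Z by lia.
  rewrite e1 in r d.
  have d' : dn h (a +z (L - q) + 1) (a +z L.+1) by apply: eq_dn d; lia.
  have ln := line_RD gh _ _ r d'.
  have [|||h1 _] := ln _ _ a (a +z q.+1)%Z; try sqlia.
  have [|||_ h4] := ln _ _ a (a +z q)%Z; try sqlia.
  by rewrite /ray_in h1 ?h4 //; lia.
have s0 := sE _ g; have s1 := sE _ G1; have s2 := sE _ G2; have s3 := sE _ G3.
have l0 := lE _ g; have l1 := lE _ G1; have l2 := lE _ G2; have l3 := lE _ G3.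
have k0 := lE _ (good_hflip g); have k1 := lE _ (good_hflip G1).
have k2 := lE _ (good_hflip G2); have k3 := lE _ (good_hflip G3).
rewrite -/c -?/g1 -?/g2 -?/g3 in s0 s1 s2 s3 l0 l1 l2 l3 k0 k1 k2 k3.
rewrite [turn c g3]turn4 in l3.
rewrite {2}(_ : f = turn c g3) ?turn_hflip in k0; last by rewrite /g3 /g2 /g1 turn4.
rewrite {2}/g1 turn_hflip in k1; rewrite {2}/g2 turn_hflip in k2; rewrite {2}/g3 turn_hflip in k3.
have d1 : deg f a a = 1 by apply: (g_deg g); sqlia.
have d2 : deg f a (a +z L.+1) = 1 by apply: (g_deg g); sqlia.
have d3 : deg f (a +z L.+1) a = 1 by apply: (g_deg g); sqlia.
have d4 : deg f (a +z L.+1) (a +z L.+1) = 1 by apply: (g_deg g); sqlia.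
have h := IH L (ltac:(lia)) (a + 1)%Z f.
have {}h := h ltac:(have := good_sub g; congr good; lia).
move=> e; lia.
Qed.

Ltac zlia := repeat match goal with
  | H : is_true _ |- _ => clear H
  | H : @eq bool _ _ |- _ => clear H
  | H : forall _, _ |- _ => clear H
  end; unfold sq in *; lia.

(** * The two main diagonals determine the field *)

Definition same f g i j := [/\ up f i j = up g i j, dn f i j = dn g i j,
  lf f i j = lf g i j & rt f i j = rt g i j].

Lemma same_sym f g i j : same f g i j -> same g f i j.
Proof. by case. Qed.

Lemma same_hflip c f g i j : same f g i (c - j) -> same (hflip c f) (hflip c g) i j.
Proof. by rewrite /same !accE; case. Qed.

Lemma same_turn c f g i j : same f g j (c - i) -> same (turn c f) (turn c g) i j.
Proof. by rewrite /same /turn !accE; case. Qed.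

Section Unique.
Variables (a b : Z).

Lemma good_dirs f i j : good a b f -> sq a b i j ->
  [/\ [|| up f i j, dn f i j, lf f i j | rt f i j],
      ~~ (up f i j && dn f i j), ~~ (lf f i j && rt f i j)
      & ~~ ((up f i j || dn f i j) && (lf f i j || rt f i j))].
Proof.
move=> g s; have := g_deg g s; rewrite /deg.
by case: (up f i j); case: (dn f i j); case: (lf f i j); case: (rt f i j).
Qed.

Lemma back_up f i j : good a b f -> sq a b i j -> sq a b (i - 1) j -> (j < b)%Z ->
  lf f i j -> up f (i - 1) j -> up f i (j + 1).
Proof.
move=> /good_hflip/good_vflip g s s' jb l u.
have := back_dn (i := (a + b - i)%Z) (j := (a + b - j)%Z) g; rewrite !vflipE !accE.
have e k : (a + b - (a + b - k) = k)%Z by zlia.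
have e1 : (a + b - (a + b - i + 1) = i - 1)%Z by zlia.
have e2 : (a + b - (a + b - j - 1) = j + 1)%Z by zlia.
by rewrite !e e1 e2; apply=> //; zlia.
Qed.

(** The inner neighbour (a+1,j) of a top point with [rt] is neither [up] nor [rt], as the dimers
    would overlap. Each of the two remaining directions makes or forbids a ray that is visible in
    the inner square, where f and g agree. *)
Lemma top_rt f g j : good a b f -> good a b g ->
  (forall i' j', sq (a + 1) (b - 1) i' j' -> same f g i' j') -> same f g a b ->
  (a < j < b)%Z -> rt f a j -> rt g a j.
Proof.
move=> gf gg inn cor jr r.
have sj : sq a b a j by zlia.
have sj1 : sq (a + 1) (b - 1) (a + 1) j by zlia.
(* Next to the corner, the dimer to the right of the point is the one to the left of the corner,
   where agreement is assumed. *)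
have [jb|jb] : (j + 1 = b \/ j + 1 < b)%Z by zlia.
  by case: cor => _ _ h _; move: r; rewrite -!(rt_lf _ _ (esym jb)) h.
have [u1 d1 l1 r1] := inn _ _ sj1.
have [c2 u2 l2 p2] := good_dirs gf sj.
have sj1' : sq a b (a + 1) j by zlia.
have [c3 u3 l3 p3] := good_dirs gf sj1'.
have [_ _ _ fc] := facing j (g_m gf) (erefl (a + 1)%Z).
have s2 : sq (a + 1) (b - 1) (a + 1) (j + 1) by zlia.
have [u4 d4 l4 r4] := inn _ _ s2.
have nu : ~~ up f (a + 1) j by rewrite (dn_up _ _ (erefl (a + 1)%Z)); move: p2; rewrite r !orbT andbT negb_or => /andP[].
move: c3; rewrite (negbTE nu) (fc r) orbF /= => /orP[d|l].
(* In f the ray goes on to two inner points; in g these form a ray as well, and its predecessor is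
   the wanted [rt]. *)
- have rr : rt f (a + 1) (j + 1) by apply: (ray_rt (g_m gf) (g_c gf) _ r d); zlia.
  rewrite d1 in d; rewrite r4 in rr.
  by have := back_rt gg _ _ _ d rr => h; apply: eq_rt (h _ _ _); zlia.
(* Only [up] competes with [rt] in g. Together with the inner [lf] it would be a ray, continued
   backwards to [up] at (a+1,j+1); in f this dimer would cover (a,j+1) from below, although that
   point is [lf]. *)
- have [c5 _ _ p5] := good_dirs gg sj.
  have [_ _ fc' _] := facing j (g_m gg) (erefl (a + 1)%Z).
  have nl : ~~ lf g a j by apply/negP => /fc'; rewrite -l1 l.
  have nd : ~~ dn g a j by rewrite -(dn_up _ _ (erefl (a + 1)%Z)) -u1.
  move: c5; rewrite (negbTE nl) (negbTE nd) /= => /orP[ug|//].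
  have ug' : up g (a + 1) (j + 1).
    have l' : lf g (a + 1) j by rewrite -l1.
    have ug1 : up g (a + 1 - 1) j by apply: eq_up ug; zlia.
    by apply: (back_up gg _ _ _ l' ug1); zlia.
  rewrite -u4 (dn_up _ _ (erefl (a + 1)%Z)) in ug'.
  have sjj : sq a b a (j + 1) by zlia.
  have [_ _ _ p6] := good_dirs gf sjj.
  by move: p6; rewrite ug' (rt_lf _ _ (erefl (j + 1)%Z)) r !orbT.
Qed.

Definition ring_agree f g := [/\ good a b f, good a b g,
  (forall i' j', sq (a + 1) (b - 1) i' j' -> same f g i' j') &
  [/\ same f g a a, same f g a b, same f g b a & same f g b b]].

Lemma ring_agree_turn f g : ring_agree f g -> ring_agree (turn (a + b) f) (turn (a + b) g).
Proof.
case=> gf gg inn [c1 c2 c3 c4]; split; [exact: good_turn|exact: good_turn| |].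
  by move=> i j s; apply/same_turn/inn; zlia.
have e1 : (a + b - a = b)%Z by zlia.
have e2 : (a + b - b = a)%Z by zlia.
by split; apply: same_turn; rewrite ?e1 ?e2.
Qed.

Lemma ring_agree_hflip f g : ring_agree f g -> ring_agree (hflip (a + b) f) (hflip (a + b) g).
Proof.
case=> gf gg inn [c1 c2 c3 c4]; split; [exact: good_hflip|exact: good_hflip| |].
  by move=> i j s; apply/same_hflip/inn; zlia.
have e1 : (a + b - a = b)%Z by zlia.
have e2 : (a + b - b = a)%Z by zlia.
by split; apply: same_hflip; rewrite ?e1 ?e2.
Qed.

Lemma ring_agree_sym f g : ring_agree f g -> ring_agree g f.
Proof.
by case=> gf gg inn [c1 c2 c3 c4]; split=> // [i j s|]; [apply/same_sym/inn|split; apply: same_sym].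
Qed.

(** [lf] follows from [rt] by reflection and [dn] is the [up] of an inner point; [up] is then
    settled because every point has exactly one direction. *)
Lemma top_same f g j : ring_agree f g -> (a <= j <= b)%Z -> same f g a j.
Proof.
move=> h jr.
have [_ _ _ [c1 c2 _ _]] := h.
have [->|[->|jr']] : (j = a \/ j = b \/ a < j < b)%Z by zlia.
- by [].
- by [].
have R f' g' j' : ring_agree f' g' -> (a < j' < b)%Z -> rt f' a j' -> rt g' a j'.
  by case=> gf gg inn [_ c _ _]; apply: top_rt.
have rE : rt f a j = rt g a j.
  by apply/idP/idP; apply: R => //; exact: ring_agree_sym.
have lE : lf f a j = lf g a j.
  have e : (a + b - (a + b - j) = j)%Z by zlia.
  have h' := ring_agree_hflip h.
  apply/idP/idP => l.
    have := R _ _ (a + b - j)%Z h'; rewrite !accE e; apply=> //; zlia.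
  have := R _ _ (a + b - j)%Z (ring_agree_sym h'); rewrite !accE e; apply=> //; zlia.
have [gf gg inn _] := h.
have s : sq a b a j by zlia.
have dE : dn f a j = dn g a j.
  rewrite -!(dn_up _ _ (erefl (a + 1)%Z)).
  by have [|] := inn (a + 1)%Z j; first by zlia.
split=> //.
have [] := good_dirs gf s; have [] := good_dirs gg s; rewrite rE lE dE.
by case: (up f a j); case: (up g a j); case: (dn g a j); case: (lf g a j); case: (rt g a j).
Qed.

Lemma ring_same f g i j : ring_agree f g -> sq a b i j -> same f g i j.
Proof.
move=> h s.
have [inn|bd] : (sq (a + 1) (b - 1) i j \/ ~ sq (a + 1) (b - 1) i j) by zlia.
  by case: h => _ _ H _; apply: H.
have e k : (a + b - (a + b - k) = k)%Z by zlia.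
have h1 := ring_agree_turn h; have h2 := ring_agree_turn h1; have h3 := ring_agree_turn h2.
have sr f' g' i' j' : same (turn (a + b) f') (turn (a + b) g') (a + b - j') i' -> same f' g' i' j'.
  by rewrite /same /turn !accE e; case.
have [ei|[ei|[ei|ei]]] : (i = a \/ i = b \/ j = a \/ j = b)%Z by sqlia.
- by rewrite ei; apply: top_same => //; zlia.
- apply/sr/sr; have -> : (a + b - i = a)%Z by zlia.
  by apply: top_same => //; zlia.
- apply/sr/sr/sr; rewrite e ei.
  by apply: top_same => //; zlia.
- by apply/sr; have -> : (a + b - j = a)%Z; [zlia|apply: top_same => //; zlia].
Qed.

End Unique.

(** The corners of every ring lie on the two main diagonals, so the field is recovered ring by ring
    from the centre outwards. *)
Theorem diagonals_determine (K : nat) : forall a b f g, (b = a +z K - 1)%Z ->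
  good a b f -> good a b g ->
  (forall i, (a <= i <= b)%Z -> same f g i i /\ same f g i (a + b - i)) ->
  forall i j, sq a b i j -> same f g i j.
Proof.
elim/ltn_ind: K => K IH a b f g eb gf gg D i j s.
apply: (@ring_same a b) => //; split=> //.
- move=> i' j' s'; have s'' := s'.
  apply: (IH (K - 2)) (good_sub gf) (good_sub gg) _ _ _ s''; try zlia.
  move=> k hk; have -> : (a + 1 + (b - 1) - k = a + b - k)%Z by zlia.
  by apply: D; zlia.
- have e1 : (a + b - a = b)%Z by zlia.
  have e2 : (a + b - b = a)%Z by zlia.
  have [|] := D a; first by zlia. 
  have [|] := D b; first by zlia. 
  by rewrite e1 e2; split.
Qed.

(** * The explicit fields *)

Lemma even_flip z z' k : (z' = z + 2 * k + 1)%Z -> Z.even z' = ~~ Z.even z.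
Proof.
move=> ->; rewrite -Z.add_assoc (Z.add_comm (2 * k)) Z.add_assoc Z.even_add_mul_2.
by rewrite Z.add_1_r Z.even_succ -Z.negb_even.
Qed.

Lemma even_same z z' k : (z' = z + 2 * k)%Z -> Z.even z' = Z.even z.
Proof. by move=> ->; rewrite Z.even_add_mul_2. Qed.

Lemma iter_turn_mod c k f : exists2 r, r < 4 & iter k (turn c) f = iter r (turn c) f.
Proof.
elim: k => [|k [r hr IH]]; first by exists 0.
rewrite iterS IH -iterS; case: (ltngtP r 3) => h; try lia; first by exists r.+1.
by exists 0 => //; rewrite h /= turn4.
Qed.

Lemma good_intro a b f : matching f -> covers a b f ->
  (forall i j, sq a b i j -> deg f i j = 1) ->
  (forall r, r < 4 -> back a b (iter r (turn (a + b)) f) /\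
     back a b (hflip (a + b) (iter r (turn (a + b)) f))) -> good a b f.
Proof.
move=> m C D B; split=> // k.
by have [r hr ->] := iter_turn_mod (a + b) k f; apply: B.
Qed.

Section Explicit.
Variables (N : Z) (A B : Z -> bool).
Hypotheses (A_range : forall k, A k -> (0 <= k < N - 1)%Z)
  (B_range : forall k, B k -> (0 <= k < N - 1)%Z)
  (AB : forall k l, A k -> B l -> (N - 1 <= k + l)%Z).

(* Strip k of the family A consists of the two antidiagonals at distances k + 1
   and k + 2 from the centre, on the side determined by the parity of k; the
   family B is the same with diagonals. A negative level is an unflipped
   central (anti)diagonal. *)
Definition levelA i j := let s := (i + j)%Z in let z := (s - (N - 1))%Z in
  if (0 <? z)%Z then (if Z.even s then z - 1 else z - 2)%Z
  else (if Z.even s then - z - 2 else - z - 1)%Z.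

Definition levelB i j := let s := (i + j)%Z in let z := (j - i)%Z in
  if (0 <? z)%Z then (if Z.even s then z - 2 else z - 1)%Z
  else (if Z.even s then - z - 1 else - z - 2)%Z.

Definition flipA i j := A (levelA i j).
Definition flipB i j := B (levelB i j).
Definition par i j := Z.even (i + j).

(** In the brick wall an even point and the odd one below it share a horizontal dimer. In a flipped
    strip of A an even point shares a vertical dimer with the odd one to its right, in a flipped
    strip of B with the odd one to its left. *)
Definition dir_up i j := [&& ~~ flipA i j, ~~ flipB i j & ~~ par i j].
Definition dir_dn i j := [&& ~~ flipA i j, ~~ flipB i j & par i j].
Definition dir_lf i j := (flipA i j && ~~ par i j) || (flipB i j && par i j).
Definition dir_rt i j := (flipA i j && par i j) || (flipB i j && ~~ par i j).

Definition insideb i j := [&& 0 <=? i, i <? N, 0 <=? j & j <? N]%Z.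

(** A dimer is present as soon as one of its two points is inside and asks for it: on the border it
    has only one point. *)
Definition phi := Field
  (fun i j => (insideb (i - 1) j && dir_dn (i - 1) j) || (insideb i j && dir_up i j))
  (fun i j => (insideb i (j - 1) && dir_rt i (j - 1)) || (insideb i j && dir_lf i j)).

Lemma inb_sq i j : sq 0 (N - 1) i j -> insideb i j.
Proof. by unfold sq; rewrite /insideb; lia. Qed.

Lemma sq_inb i j : insideb i j -> sq 0 (N - 1) i j.
Proof. by unfold sq; rewrite /insideb; lia. Qed.

Lemma par_flip i j i' j' k : (i' + j' = i + j + 2 * k + 1)%Z -> par i' j' = ~~ par i j.
Proof. exact: even_flip. Qed.

Lemma par_same i j i' j' k : (i' + j' = i + j + 2 * k)%Z -> par i' j' = par i j.
Proof. exact: even_same. Qed.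

Lemma flipA_line i j i' j' : (i' + j' = i + j)%Z -> flipA i' j' = flipA i j.
Proof. by rewrite /flipA /levelA => ->. Qed.

Lemma flipB_line i j i' j' : (j' - i' = j - i)%Z -> flipB i' j' = flipB i j.
Proof.
by move=> e; rewrite /flipB /levelB e (@even_same (i + j) (i' + j') (i' - i)) //; lia.
Qed.

Lemma A_neg k : (k < 0)%Z -> A k = false.
Proof. by move=> h; apply/negP => /A_range; lia. Qed.
Lemma B_neg k : (k < 0)%Z -> B k = false.
Proof. by move=> h; apply/negP => /B_range; lia. Qed.

(** An even antidiagonal and the next odd one have the same level, except across the centre, where
    both levels are negative and hence unflipped. *)
Lemma flipA_band i j i' j' : par i j -> (i' + j' = i + j + 1)%Z -> flipA i' j' = flipA i j.
Proof.
rewrite /par => p e; rewrite /flipA /levelA e p (@even_flip (i + j) _ 0) ?p /=; last by lia.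
by do 2!case: Z.ltb_spec => ? //; try (by f_equal; lia); try lia; rewrite !A_neg //; lia.
Qed.

Lemma flipB_band i j i' j' : par i j -> (j' - i' = j - i - 1)%Z -> flipB i' j' = flipB i j.
Proof.
rewrite /par => p e.
have -> : flipB i' j' = B (let z := (j - i - 1)%Z in if (0 <? z)%Z then z - 1 else - z - 2)%Z.
  by rewrite /flipB /levelB e (@even_flip (i + j) _ (i' - i - 1)) ?p; [|lia].
rewrite /flipB /levelB p /=.
by do 2!case: Z.ltb_spec => ? //; try (by f_equal; lia); try lia; rewrite !B_neg //; lia.
Qed.

Lemma levelA_le i j : (levelA i j <= Z.abs (i + j - (N - 1)) - 1)%Z.
Proof.
by rewrite /levelA; case: Z.ltb_spec => ? /=; case: Z.even; lia.
Qed.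

Lemma levelB_le i j : (levelB i j <= Z.abs (j - i) - 1)%Z.
Proof.
by rewrite /levelB; case: Z.ltb_spec => ? /=; case: Z.even; lia.
Qed.

(** In the square, |i + j - (N - 1)| + |j - i| is at most N - 1. Taking the second term at a
    neighbouring point adds at most one, as a diagonal step changes only one of the two terms. The
    levels are smaller than these distances, so they total at most N - 2, against [AB]. *)
Lemma nocross i j i' j' : insideb i j -> insideb i' j' ->
  (-1 <= i' - i <= 1)%Z -> (-1 <= j' - j <= 1)%Z -> flipA i j -> flipB i' j' -> False.
Proof.
move=> s s' di dj a b; have := AB a b; have := @levelA_le i j; have := @levelB_le i' j'.
by move: s s'; rewrite /insideb; lia.
Qed.

(** An even point and the odd one below it lie in a common strip of both families, so they agree
    about the dimer between them. *)
Lemma dir_dn_up i j i' : (i' = i + 1)%Z -> dir_dn i j = dir_up i' j.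
Proof.
move=> e; rewrite /dir_dn /dir_up (@par_flip i j i' j 0); last by lia.
case p: (par i j); rewrite ?andbF //= (flipA_band p) ?(flipB_band p) //; lia.
Qed.

Lemma dir_rt_lf i j j' : (j' = j + 1)%Z -> dir_rt i j = dir_lf i j'.
Proof.
move=> e; rewrite /dir_rt /dir_lf (@par_flip i j i j' 0); last by lia.
case p: (par i j); rewrite ?andbF ?andbT ?orbF ?orFb //=.
  by rewrite (flipA_band p) //; lia.
have p' : par i j' by rewrite (@par_flip i j i j' 0) ?p //; lia.
by rewrite (@flipB_band i j' i j) //; lia.
Qed.

Lemma up_phi i j : insideb i j -> up phi i j = dir_up i j.
Proof.
move=> s; rewrite /up /= s /=; case: (boolP (insideb (i - 1) j)) => //= s'.
by rewrite (@dir_dn_up _ _ i) ?orbb //; lia.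
Qed.

Lemma dn_phi i j : insideb i j -> dn phi i j = dir_dn i j.
Proof.
move=> s; rewrite /dn /=; have -> : (i + 1 - 1 = i)%Z by lia.
rewrite s /=; case: (boolP (insideb (i + 1) j)) => //= s'; last by rewrite orbF.
by rewrite -(@dir_dn_up i) ?orbb //; lia.
Qed.

Lemma lf_phi i j : insideb i j -> lf phi i j = dir_lf i j.
Proof.
move=> s; rewrite /lf /= s /=; case: (boolP (insideb i (j - 1))) => //= s'.
by rewrite (@dir_rt_lf _ _ j) ?orbb //; lia.
Qed.

Lemma rt_phi i j : insideb i j -> rt phi i j = dir_rt i j.
Proof.
move=> s; rewrite /rt /=; have -> : (j + 1 - 1 = j)%Z by lia.
rewrite s /=; case: (boolP (insideb i (j + 1))) => //= s'; last by rewrite orbF.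
by rewrite -(@dir_rt_lf i j) ?orbb //; lia.
Qed.

Lemma phi_exclusive i j : insideb i j -> dir_up i j + dir_dn i j + dir_lf i j + dir_rt i j = 1.
Proof.
move=> s; have := @nocross i j i j s s ltac:(lia) ltac:(lia).
rewrite /dir_up /dir_dn /dir_lf /dir_rt; case: (flipA i j); case: (flipB i j); case: (par i j) => //= h.
- by case: h.
- by case: h.
Qed.

Lemma matching_phi : matching phi.
Proof.
split=> /=.
(* [eh i j] occurs only with i + j odd, which cannot hold in two consecutive columns. *)
- move=> i j j' e; have -> : dir_dn (i - 1) j' = par (i - 1) j' && dir_dn (i - 1) j'.
    by rewrite /dir_dn; case: (par _ _); rewrite ?andbF.
  have -> : dir_dn (i - 1) j = par (i - 1) j && dir_dn (i - 1) j.
    by rewrite /dir_dn; case: (par _ _); rewrite ?andbF.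
  have -> : dir_up i j' = ~~ par i j' && dir_up i j'.
    by rewrite /dir_up; case: (par _ _); rewrite ?andbF.
  have -> : dir_up i j = ~~ par i j && dir_up i j.
    by rewrite /dir_up; case: (par _ _); rewrite ?andbF.
  rewrite (@par_flip (i - 1) j (i - 1) j' 0) ?(@par_flip (i - 1) j i j 0)
    ?(@par_same (i - 1) j i j' 1); lia.
(* Whether [ev i j] stems from A or from B is decided by the parity of i + j. Two overlapping
   vertical dimers would thus come from different families flipped at neighbouring points, against
   [nocross]. *)
- move=> i i' j e.
  have X u v u' v' : insideb u v -> insideb u' v' -> (-1 <= u' - u <= 1)%Z -> (-1 <= v' - v <= 1)%Z ->
      (flipA u v && flipB u' v') = false.
    by move=> s s' h1 h2; apply/negP => /andP[]; apply: nocross.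
  have p1 : par i j = ~~ par i (j - 1) by apply: (@par_flip _ _ _ _ 0); lia.
  have p2 : par i' (j - 1) = ~~ par i (j - 1) by apply: (@par_flip _ _ _ _ 0); lia.
  have p3 : par i' j = par i (j - 1) by apply: (@par_same _ _ _ _ 1); lia.
  have Y u v u' v' q : insideb u v -> insideb u' v' -> (-1 <= u' - u <= 1)%Z -> (-1 <= v' - v <= 1)%Z ->
      (flipA u v && q || flipB u v && ~~ q) -> (flipA u' v' && ~~ q || flipB u' v' && q) -> False.
    move=> s s' h1 h2; have := X _ _ _ _ s s' h1 h2; have := X _ _ _ _ s' s ltac:(lia) ltac:(lia).
    by case: q; case: (flipA u v); case: (flipB u v); case: (flipA u' v'); case: (flipB u' v').
  rewrite /dir_rt /dir_lf p1 p2 p3 ?negbK.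
  by case/orP=> /andP[s h] /orP[] /andP[s' h']; apply: (Y _ _ _ _ _ s s' _ _ h h'); zlia.
(* The point (i,j) would have a horizontal and a vertical dimer. It is inside: the horizontal dimer
   bounds its column, the vertical one its row. *)
- move=> i j i' j' ei ej h v.
  have s : insideb i j.
    by case/orP: h => /andP[h _]; case/orP: v => /andP[v _]; move: h v; rewrite /insideb; lia.
  have hh : dir_up i j || dir_dn i j.
    case: ei => e; [rewrite -up_phi //|rewrite -dn_phi // orbC]; apply/orP; left;
      by rewrite /up /dn -?e.
  have vv : dir_lf i j || dir_rt i j.
    case: ej => e; [rewrite -lf_phi //|rewrite -rt_phi // orbC]; apply/orP; left;
      by rewrite /lf /rt -?e.
  have := phi_exclusive s; move: hh vv.
  by case: (dir_up i j); case: (dir_dn i j); case: (dir_lf i j); case: (dir_rt i j).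
Qed.

(** This and the next three lemmas yield the [back] conditions. An even [dn] and an odd [rt] (or an
    odd [up] and an even [lf]) mean that the vertical dimer stems from B, and flips of B are
    constant along diagonals. *)
Lemma pH_delta i j i' j' i'' j'' : par i' j' = ~~ par i j -> (j'' - i'' = j' - i')%Z ->
  (dir_dn i j -> dir_rt i' j' -> dir_rt i'' j'') /\ (dir_up i j -> dir_lf i' j' -> dir_lf i'' j'').
Proof.
move=> p e; rewrite /dir_dn /dir_rt /dir_up /dir_lf (flipB_line e) p.
rewrite (@par_same i' j' i'' j'' (i'' - i')) ?p; last by lia.
by split; case/and3P => _ _ /=; case: (par i j) => //= _; rewrite !andbF !orFb !andbT => ->;
  rewrite ?orbT.
Qed.

Lemma pH_sigma i j i' j' i'' j'' : par i' j' = ~~ par i j -> (i'' + j'' = i' + j')%Z ->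
  (dir_up i j -> dir_rt i' j' -> dir_rt i'' j'') /\ (dir_dn i j -> dir_lf i' j' -> dir_lf i'' j'').
Proof.
move=> p e; rewrite /dir_dn /dir_rt /dir_up /dir_lf (flipA_line e) p.
rewrite (@par_same i' j' i'' j'' 0) ?p; last by lia.
by split; case/and3P => _ _ /=; case: (par i j) => //= _; rewrite !andbF !orbF !andbT => ->.
Qed.

Definition near i j i' j' := (-1 <= i' - i <= 1 /\ -1 <= j' - j <= 1)%Z.

(** Here the horizontal dimer has to propagate. Along the diagonal B stays unflipped, and A is
    unflipped because a flipped point of B is near. *)
Lemma pV_delta i j i' j' i'' j'' : par i' j' = ~~ par i j -> (j'' - i'' = j - i)%Z ->
  insideb i' j' -> insideb i'' j'' -> near i'' j'' i' j' ->
  (dir_rt i' j' -> dir_dn i j -> dir_dn i'' j'') /\ (dir_lf i' j' -> dir_up i j -> dir_up i'' j'').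
Proof.
move=> p e s s' [d1 d2].
have X := nocross s' s d1 d2; move: X.
rewrite /dir_dn /dir_rt /dir_up /dir_lf (flipB_line e) p.
rewrite (@par_same i j i'' j'' (i'' - i)) ?p; last by lia.
by case: (par i j); case: (flipA i j); case: (flipB i j); case: (flipA i' j'); case: (flipB i' j');
  case: (flipA i'' j'') => //= X; split=> //; case: X.
Qed.

Lemma pV_sigma i j i' j' i'' j'' : par i' j' = ~~ par i j -> (i'' + j'' = i + j)%Z ->
  insideb i' j' -> insideb i'' j'' -> near i' j' i'' j'' ->
  (dir_lf i' j' -> dir_dn i j -> dir_dn i'' j'') /\ (dir_rt i' j' -> dir_up i j -> dir_up i'' j'').
Proof.
move=> p e s s' [d1 d2].
have X := nocross s s' d1 d2; move: X.
rewrite /dir_dn /dir_rt /dir_up /dir_lf (flipA_line e) p.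
rewrite (@par_same i j i'' j'' 0) ?p; last by lia.
by case: (par i j); case: (flipA i j); case: (flipB i j); case: (flipA i' j'); case: (flipB i' j');
  case: (flipB i'' j'') => //= X; split=> //; case: X.
Qed.

Lemma par_next i j i' j' :
  ((i' = i /\ (j' = j + 1 \/ j' = j - 1)) \/ (j' = j /\ (i' = i + 1 \/ i' = i - 1)))%Z ->
  par i' j' = ~~ par i j.
Proof.
move=> h; have [e|e] : (i' + j' = i + j + 1 \/ i' + j' = i + j - 1)%Z by lia.
  by apply: (@par_flip _ _ _ _ 0); lia.
by apply: (@par_flip _ _ _ _ (-1)); lia.
Qed.

Lemma good_phi : good 0 (N - 1) phi.
Proof.
have m := matching_phi.
have DE := dn_phi. have UE := up_phi.
have LE := lf_phi. have RE := rt_phi.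
apply: good_intro => //.
- move=> i j /inb_sq s; rewrite UE // DE // LE // RE //.
  by have := phi_exclusive s; case: (dir_up i j); case: (dir_dn i j); case: (dir_lf i j); case: (dir_rt i j).
- move=> i j /inb_sq s; rewrite /deg UE // DE // LE // RE //.
  exact: phi_exclusive.
- have iE i j : sq 0 (N - 1) i j <-> insideb i j by split; [exact: inb_sq|exact: sq_inb].
  move=> r hr; have [->|[->|[->|->]]] : r = 0 \/ r = 1 \/ r = 2 \/ r = 3 by lia.
  + split=> i j s s' ai; rewrite /iter ?accE.
    * rewrite DE ?RE; try (apply: inb_sq; sqlia).
      by apply: (proj1 (pH_delta _ _)); [apply: par_next|]; lia.
    * rewrite DE ?LE; try (apply: inb_sq; sqlia).
      by apply: (proj2 (pH_sigma _ _)); [apply: par_next|]; lia.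
  + split=> i j s s' ai; rewrite /iter /turn ?accE.
    * rewrite DE ?LE ?DE; try (apply: inb_sq; sqlia).
      move=> h1 h2; move: h1 h2; apply: (proj1 (pV_sigma _ _ _ _ _)); [apply: par_next|..];
         try (apply: inb_sq; sqlia); rewrite /near; lia.
    * rewrite UE ?LE ?UE; try (apply: inb_sq; sqlia).
      by apply: (proj2 (pV_delta _ _ _ _ _)); [apply: par_next|..];
         try (apply: inb_sq; sqlia); rewrite /near; lia.
  + split=> i j s s' ai; rewrite /iter /turn ?accE.
    * rewrite UE ?LE; try (apply: inb_sq; sqlia).
      by apply: (proj2 (pH_delta _ _)); [apply: par_next|]; lia.
    * rewrite UE ?RE; try (apply: inb_sq; sqlia).
      by apply: (proj1 (pH_sigma _ _)); [apply: par_next|]; lia.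
  + split=> i j s s' ai; rewrite /iter /turn ?accE.
    * rewrite UE ?RE ?UE; try (apply: inb_sq; sqlia).
      by apply: (proj2 (pV_sigma _ _ _ _ _)); [apply: par_next|..];
         try (apply: inb_sq; sqlia); rewrite /near; lia.
    * rewrite DE ?RE ?DE; try (apply: inb_sq; sqlia).
      by apply: (proj1 (pV_delta _ _ _ _ _)); [apply: par_next|..];
         try (apply: inb_sq; sqlia); rewrite /near; lia.
Qed.

End Explicit.

(** * Reading off the flipped strips *)

Lemma switch (P : Z -> bool) x y : (x <= y)%Z -> P x -> ~~ P y ->
  exists z, [/\ (x <= z < y)%Z, P z & ~~ P (z + 1)%Z].
Proof.
move=> xy; have -> : y = (x +z Z.to_nat (y - x))%Z by lia.
elim: (Z.to_nat (y - x)) => [|t IH]; first by rewrite Z.add_0_r => ->.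
move=> px; case E: (P (x +z t)%Z) => pt; last first.
  by have [z [? ? ?]] := IH px (negbT E); exists z; split=> //; lia.
exists (x +z t)%Z; split=> //; first by lia.
by move: pt; congr (is_true (~~ P _)); lia.
Qed.

Section Diagonal.
Variables (a b : Z).

Lemma not_dirs f i j : good a b f -> sq a b i j ->
  [/\ up f i j -> dn f i j = false /\ lf f i j = false /\ rt f i j = false,
      dn f i j -> up f i j = false /\ lf f i j = false /\ rt f i j = false,
      lf f i j -> up f i j = false /\ dn f i j = false /\ rt f i j = false &
      rt f i j -> up f i j = false /\ dn f i j = false /\ lf f i j = false].
Proof.
move=> g s; have [_] := good_dirs g s.
by case: (up f i j); case: (dn f i j); case: (lf f i j); case: (rt f i j).
Qed.

(** A switch from [dn] to [rt] along a diagonal makes (i+1,j) an [up] beside an [rt], which is a ray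
    crossing that diagonal. The other chord lemmas are its images under symmetries. *)
Lemma chordA1 f i j : good a b f -> sq a b i j -> sq a b (i + 1) (j + 1) ->
  dn f i j -> rt f (i + 1) (j + 1) -> forall i' j', sq a b i' j' ->
  ((i' + j' = i + j + 1)%Z -> up f i' j') /\ ((i' + j' = i + j + 2)%Z -> rt f i' j').
Proof.
move=> g s s' d r i' j' s1.
have u : up f (i + 1) j by rewrite (dn_up _ _ (erefl (i + 1)%Z)).
have s2 : sq a b (i + 1) j by sqlia.
have [h1 h2] := line_UR g s2 s' u r s1.
by split=> e; [apply: h1|apply: h2]; clear -e; lia.
Qed.

Lemma chordA2 f i j : good a b f -> sq a b i j -> sq a b (i + 1) (j + 1) ->
  rt f i j -> dn f (i + 1) (j + 1) -> forall i' j', sq a b i' j' ->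
  ((i' + j' = i + j + 1)%Z -> lf f i' j') /\ ((i' + j' = i + j + 2)%Z -> dn f i' j').
Proof.
move=> /good_tr g s s' r d i' j' s1.
have t i1 j1 : sq a b i1 j1 -> sq a b j1 i1 by sqlia.
have [h1 h2] := chordA1 g (t _ _ s) (t _ _ s') r d (t _ _ s1).
by split=> e; [apply: h1|apply: h2]; clear -e; lia.
Qed.

Let c := (a + b)%Z.
Let cc k : (c - (c - k) = k)%Z. Proof. by rewrite /c; lia. Qed.
Let c1 k : (c - (k - 1) = c - k + 1)%Z. Proof. by rewrite /c; lia. Qed.
Let sqf i j : sq a b i j -> sq a b i (c - j). Proof. by rewrite /c; sqlia. Qed.
Let sqr i j : sq a b i j -> sq a b (c - i) (c - j). Proof. by rewrite /c; sqlia. Qed.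

Lemma chordB1 f i j : good a b f -> sq a b i j -> sq a b (i + 1) (j - 1) ->
  dn f i j -> lf f (i + 1) (j - 1) -> forall i' j', sq a b i' j' ->
  ((j' - i' = j - i - 1)%Z -> up f i' j') /\ ((j' - i' = j - i - 2)%Z -> lf f i' j').
Proof.
move=> /good_hflip; rewrite -/c => g /sqf s /sqf s' d r i' j' /sqf s1.
have := chordA1 g s _ _ _ s1; rewrite !accE -c1 !cc => h.
have [h1 h2] := h s' d r.
by split=> e; [apply: h1|apply: h2]; clear -e; lia.
Qed.

Lemma chordB2 f i j : good a b f -> sq a b i j -> sq a b (i + 1) (j - 1) ->
  lf f i j -> dn f (i + 1) (j - 1) -> forall i' j', sq a b i' j' ->
  ((j' - i' = j - i - 1)%Z -> rt f i' j') /\ ((j' - i' = j - i - 2)%Z -> dn f i' j').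
Proof.
move=> /good_hflip; rewrite -/c => g /sqf s /sqf s' d r i' j' /sqf s1.
have := chordA2 g s _ _ _ s1; rewrite !accE -c1 !cc => h.
have [h1 h2] := h s' d r.
by split=> e; [apply: h1|apply: h2]; clear -e; lia.
Qed.

Lemma chordB3 f i j : good a b f -> sq a b i j -> sq a b (i + 1) (j - 1) ->
  rt f i j -> up f (i + 1) (j - 1) -> forall i' j', sq a b i' j' ->
  ((j' - i' = j - i)%Z -> rt f i' j') /\ ((j' - i' = j - i - 1)%Z -> dn f i' j').
Proof.
move=> /good_hflip/good_vflip; rewrite -/c => g /sqr s /sqr s' d r i' j' /sqr s1.
have := chordB1 (i := (c - (i + 1))%Z) (j := (c - (j - 1))%Z) g s' _ _ _ s1; rewrite !vflipE !accE !cc.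
have -> : (c - (i + 1) + 1 = c - i)%Z by lia.
have -> : (c - (j - 1) - 1 = c - j)%Z by lia.
rewrite !cc => h; have [h1 h2] := h s r d.
by split=> e; [apply: h2|apply: h1]; clear -e; lia.
Qed.

Lemma chordB4 f i j : good a b f -> sq a b i j -> sq a b (i + 1) (j - 1) ->
  up f i j -> rt f (i + 1) (j - 1) -> forall i' j', sq a b i' j' ->
  ((j' - i' = j - i)%Z -> up f i' j') /\ ((j' - i' = j - i - 1)%Z -> lf f i' j').
Proof.
move=> /good_hflip/good_vflip; rewrite -/c => g /sqr s /sqr s' d r i' j' /sqr s1.
have := chordB2 (i := (c - (i + 1))%Z) (j := (c - (j - 1))%Z) g s' _ _ _ s1; rewrite !vflipE !accE !cc.
have -> : (c - (i + 1) + 1 = c - i)%Z by lia.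
have -> : (c - (j - 1) - 1 = c - j)%Z by lia.
rewrite !cc => h; have [h1 h2] := h s r d.
by split=> e; [apply: h2|apply: h1]; clear -e; lia.
Qed.

(** A dimer below (i,j) rules out [up] and [lf] at (i+1,j+1). A dimer above (i,j) leaves [dn] or
    [rt] for (i,j+1): [dn] is [up] at (i+1,j+1), and [rt] is part of a ray whose next step is [lf]
    there. The rest is transposition. *)
Lemma diag_next f i j : good a b f -> sq a b i j -> sq a b (i + 1) (j + 1) ->
  (dn f i j || rt f i j) = (dn f (i + 1) (j + 1) || rt f (i + 1) (j + 1)).
Proof.
have half f' i' j' : good a b f' -> sq a b i' j' -> sq a b (i' + 1) (j' + 1) ->
    (dn f' i' j' -> dn f' (i' + 1) (j' + 1) || rt f' (i' + 1) (j' + 1)) /\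
    (up f' i' j' -> up f' (i' + 1) (j' + 1) || lf f' (i' + 1) (j' + 1)).
  move=> g s s'.
  have s2 : sq a b (i' + 1) j' by sqlia.
  have s3 : sq a b i' (j' + 1) by sqlia.
  have [ex _ _ _] := good_dirs g s'.
  have [U1 D1 L1 R1] := not_dirs g s.
  have [U2 D2 L2 R2] := not_dirs g s'.
  have [U3 D3 L3 R3] := not_dirs g s2.
  have [U4 D4 L4 R4] := not_dirs g s3.
  have [ex4 _ _ _] := good_dirs g s3.
  split=> h.
    have u : up f' (i' + 1) j' by rewrite (dn_up _ _ (erefl (i' + 1)%Z)).
    have [f1 _ _ _] := facing (i' + 1)%Z (g_m g) (erefl (j' + 1)%Z).
    have l : lf f' (i' + 1) (j' + 1) = false.
      by rewrite (rt_lf _ _ (erefl (j' + 1)%Z)); case: (U3 u) => _ [_ ->].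
    by move: ex; rewrite (f1 u) l.
  have [f1 _ _ _] := facing i' (g_m g) (erefl (j' + 1)%Z).
  have l : lf f' i' (j' + 1) = false.
    by rewrite (rt_lf _ _ (erefl (j' + 1)%Z)); case: (U1 h) => _ [_ ->].
  move: ex4; rewrite (f1 h) l /= => /orP[d|r].
    by rewrite (dn_up _ _ (erefl (i' + 1)%Z)) d.
  have [_ h2] := line_UR g s s3 h r s2.
  by rewrite (rt_lf _ _ (erefl (j' + 1)%Z)) h2 ?orbT //; clear; lia.
move=> g s s'.
have t i1 j1 : sq a b i1 j1 -> sq a b j1 i1 by sqlia.
have [hd hu] := half f i j g s s'.
have [hr hl] := half _ _ _ (good_tr g) (t _ _ s) (t _ _ s').
rewrite !accE in hr hl.
have [ex _ _ _] := good_dirs g s.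
have [U D L R] := not_dirs g s'.
have no : up f (i + 1) (j + 1) || lf f (i + 1) (j + 1) ->
    dn f (i + 1) (j + 1) || rt f (i + 1) (j + 1) = false.
  by case/orP=> [/U[-> [_ ->]]|/L[_ [-> ->]]].
apply/idP/idP; first by case/orP=> [/hd|/hr] //; rewrite orbC.
move=> h; case/or4P: ex => [/hu|->|/hl|->]; rewrite ?orbT // => h'.
  by rewrite no in h.
by rewrite no // orbC in h.
Qed.

Lemma diag_const f i j (t : nat) : good a b f -> sq a b i j -> sq a b (i +z t) (j +z t) ->
  (dn f i j || rt f i j) = (dn f (i +z t) (j +z t) || rt f (i +z t) (j +z t)).
Proof.
move=> g s; elim: t => [|t IH] st; first by rewrite !Z.add_0_r.
rewrite IH; last by sqlia.
have -> : (i +z t.+1 = i +z t + 1)%Z by lia.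
have -> : (j +z t.+1 = j +z t + 1)%Z by lia.
by apply: diag_next => //; sqlia.
Qed.

Lemma main_diag f i j : good a b f -> sq a b i i -> sq a b j j ->
  (dn f i i || rt f i i) = (dn f j j || rt f j j).
Proof.
move=> g; wlog ij : i j / (i <= j)%Z.
  have [ij|ij] : (i <= j \/ j <= i)%Z by lia.
    by apply.
  by move=> H si sj; symmetry; apply: H.
move=> si sj; have := @diag_const f i i (Z.to_nat (j - i)) g si.
have -> : (i +z Z.to_nat (j - i) = j)%Z by lia.
by apply.
Qed.

Lemma anti_diag f i j : good a b f -> sq a b i i -> sq a b j j ->
  (dn f i (a + b - i) || lf f i (a + b - i)) = (dn f j (a + b - j) || lf f j (a + b - j)).
Proof.
by move=> /good_hflip g si sj; have := main_diag g si sj; rewrite !accE.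
Qed.

End Diagonal.

Lemma half_even z k : (z = 2 * k)%Z -> (z / 2 = k)%Z.
Proof. by move=> ->; rewrite Z.mul_comm Z.div_mul. Qed.

Lemma half_odd z k : (z = 2 * k + 1)%Z -> (z / 2 = k)%Z.
Proof. by move=> ->; rewrite Z.mul_comm Z.div_add_l //= Z.add_0_r. Qed.

Lemma even_double z k : (z = 2 * k)%Z -> Z.even z = true.
Proof. by move=> ->; rewrite Z.even_mul. Qed.

Lemma even_double1 z k : (z = 2 * k + 1)%Z -> Z.even z = false.
Proof. by move=> ->; rewrite Z.even_add Z.even_mul. Qed.

Lemma parity z : (exists k, z = 2 * k \/ z = 2 * k + 1)%Z.
Proof. by exists (z / 2)%Z; have := Z.div_mod z 2; have := Z.mod_pos_bound z 2; lia. Qed.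

Section Extract.
Variables (N h : Z) (f : field).
(** For odd N, (h,h) is the centre; for even N it is the upper left one of the four central points.
    [base] selects one of the four possibilities there. *)
Hypotheses (hN : (N = 2 * h + 1 \/ N = 2 * h + 2)%Z) (h0 : (0 <= h)%Z).
Hypotheses (g : good 0 (N - 1) f) (base : dn f h h).

(* Rows where strip k, resp. l, meets the main diagonal, resp. antidiagonal. *)
Definition rowA k := if Z.even (k - N) then ((N + k) / 2)%Z else ((N - 3 - k) / 2)%Z.
Definition rowB l := if Z.even l then ((N - 2 - l) / 2)%Z else ((N + 1 + l) / 2)%Z.

Definition readA k := [&& 0 <=? k, k <? N - 1 & rt f (rowA k) (rowA k)]%Z.
Definition readB l := [&& 0 <=? l, l <? N - 1 &
  lf f (rowB l) (N - 1 - rowB l) || rt f (rowB l) (N - 1 - rowB l)]%Z.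

Lemma readA_range k : readA k -> (0 <= k < N - 1)%Z.
Proof. by case/and3P => /Z.leb_le ? /Z.ltb_lt ? _. Qed.

Lemma readB_range k : readB k -> (0 <= k < N - 1)%Z.
Proof. by case/and3P => /Z.leb_le ? /Z.ltb_lt ? _. Qed.

Let P := (0 <= h <= N - 1)%Z.
Let hP : P. Proof. by rewrite /P; lia. Qed.

Lemma main_dn_rt i : (0 <= i <= N - 1)%Z -> dn f i i || rt f i i.
Proof.
move=> hi; rewrite (main_diag (j := h) g); [by rewrite base| |];
  by move: hP; rewrite /P; sqlia.
Qed.

Lemma anti_odd i : (N = 2 * h + 1)%Z -> (0 <= i <= N - 1)%Z ->
  dn f i (N - 1 - i) || lf f i (N - 1 - i).
Proof.
move=> e hi; have -> : (N - 1 - i = 0 + (N - 1) - i)%Z by lia.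
rewrite (anti_diag (j := h) g); try by move: hP; rewrite /P; sqlia.
by have -> : (0 + (N - 1) - h = h)%Z; [lia|rewrite base].
Qed.

(** For even N the antidiagonal misses (h,h) but contains (h+1,h), which the dimer of [base] covers
    from above. *)
Lemma anti_even i : (N = 2 * h + 2)%Z -> (0 <= i <= N - 1)%Z ->
  up f i (N - 1 - i) || rt f i (N - 1 - i).
Proof.
move=> e hi.
have s : sq 0 (N - 1) i (N - 1 - i) by sqlia.
have u : up f (h + 1) h by rewrite (dn_up _ _ (erefl (h + 1)%Z)).
have sh : sq 0 (N - 1) (h + 1) h by move: hP; rewrite /P; sqlia.
have := anti_diag (i := i) (j := (h + 1)%Z) g; rewrite Z.add_0_l.
have -> : (N - 1 - (h + 1) = h)%Z by lia.
have [U _ _ _] := not_dirs g sh.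
have [-> [-> _]] := U u.
have [ex _ _ _] := good_dirs g s.
move=> H; have {}H := H ltac:(sqlia) ltac:(move: hP; rewrite /P; sqlia).
move/negbT: H; rewrite negb_or => /andP[/negbTE d /negbTE l].
by move: ex; rewrite d l.
Qed.

(** Between the centre, which is [dn], and the flipped point, which is [rt], the direction along the
    main diagonal switches. The switch lies on a full chord of some level k0 <= k, which suffices
    for bounding k + l from below. *)
Lemma chord_of_A k : readA k -> exists k0, (0 <= k0 <= k)%Z /\
  ((exists m, k0 = N + 2 * m /\ forall i j, sq 0 (N - 1) i j ->
     (i + j = N - 1 + k0 -> up f i j) /\ (i + j = N + k0 -> rt f i j)) \/
   (exists m, k0 = N + 2 * m + 1 /\ forall i j, sq 0 (N - 1) i j ->
     (i + j = N - 1 - k0 -> dn f i j) /\ (i + j = N - 2 - k0 -> lf f i j)))%Z.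
Proof.
case/and3P => /Z.leb_le k1 /Z.ltb_lt k2; rewrite /rowA; have [m [e|e]] := parity (k - N).
- rewrite (even_double e) (@half_even _ (N + m)%Z); last by zlia.
  move=> r; have s : sq 0 (N - 1) (N + m) (N + m) by zlia.
  have [_ _ _ R] := not_dirs g s; have [_ [nd _]] := R r.
  have [|z [hz dz nz]] := @switch (fun z => dn f z z) h (N + m)%Z _ base (negbT nd); first by zlia.
  have rz : rt f (z + 1) (z + 1).
    by have := main_dn_rt (i := (z + 1)%Z); rewrite (negbTE nz) => H; apply: (H _); zlia.
  exists (2 * z + 2 - N)%Z; split; first by zlia.
  left; exists (z + 1 - N)%Z; split; first by zlia.
  move=> i j sij; have [||h1 h2] := chordA1 g _ _ dz rz sij; [zlia|zlia|].
  by split=> ?; [apply: h1|apply: h2]; zlia.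
- rewrite (even_double1 e) (@half_even _ (-2 - m)%Z); last by zlia.
  move=> r; have s : sq 0 (N - 1) h h by zlia.
  have [_ D _ _] := not_dirs g s; have [_ [_ nr]] := D base.
  have [|z [hz dz nz]] := @switch (fun z => rt f z z) (-2 - m)%Z h _ r (negbT nr); first by zlia.
  have rz : dn f (z + 1) (z + 1).
    by have := main_dn_rt (i := (z + 1)%Z); rewrite (negbTE nz) orbF => H; apply: (H _); zlia.
  exists (N - 3 - 2 * z)%Z; split; first by zlia.
  right; exists (- 2 - z)%Z; split; first by zlia.
  move=> i j sij; have [||h1 h2] := chordA2 g _ _ dz rz sij; [zlia|zlia|].
  by split=> ?; [apply: h2|apply: h1]; zlia.
Qed.

(** The same along the antidiagonal, where the directions are [dn] or [lf] for odd N and [up] or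
    [rt] for even N; together with the side of the centre this makes four cases. *)
Lemma chord_of_B l : readB l -> exists l0, (0 <= l0 <= l)%Z /\
  ((exists m, l0 = 2 * m /\ forall i j, sq 0 (N - 1) i j ->
     (j - i = l0 -> dn f i j) /\ (j - i = l0 + 1 -> rt f i j)) \/
   (exists m, l0 = 2 * m + 1 /\ forall i j, sq 0 (N - 1) i j ->
     (j - i = - l0 -> up f i j) /\ (j - i = - l0 - 1 -> lf f i j)))%Z.
Proof.
case/and3P => /Z.leb_le l1 /Z.ltb_lt l2; rewrite /rowB; have [m [e|e]] := parity l.
- rewrite (even_double e); case: hN => eN.
  + rewrite (@half_odd _ (h - 1 - m)%Z); last by zlia.
    have hi : (0 <= h - 1 - m <= N - 1)%Z by zlia.
    set y := (N - 1 - (h - 1 - m))%Z => r.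
    have s : sq 0 (N - 1) (h - 1 - m) y by zlia.
    have [_ D _ R] := not_dirs g s.
    have {}r : lf f (h - 1 - m) y.
      by case/orP: r => // /R[_ [d _]]; have := anti_odd eN hi; rewrite -/y d.
    have sh : sq 0 (N - 1) h h by zlia.
    have [_ Dh _ _] := not_dirs g sh; have [_ [nl _]] := Dh base.
    have nl' : ~~ lf f h (N - 1 - h) by have -> : (N - 1 - h = h)%Z; [zlia|rewrite nl].
    have [|z [hz dz nz]] := @switch (fun z => lf f z (N - 1 - z)) (h - 1 - m)%Z h _ r nl'.
      by zlia.
    have rz : dn f (z + 1) (N - 1 - z - 1).
      have := anti_odd (i := (z + 1)%Z) eN; rewrite (negbTE nz) orbF => H.
      by apply: eq_dn (H _); zlia.
    exists (N - 3 - 2 * z)%Z; split; first by zlia.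
    left; exists (h - 1 - z)%Z; split; first by zlia.
    move=> i j sij; have [||h1 h2] := chordB2 g _ _ dz rz sij; [zlia|zlia|].
    by split=> ?; [apply: h2|apply: h1]; zlia.
  + rewrite (@half_even _ (h - m)%Z); last by zlia.
    have hi : (0 <= h - m <= N - 1)%Z by zlia.
    set y := (N - 1 - (h - m))%Z => r.
    have s : sq 0 (N - 1) (h - m) y by zlia.
    have [U _ L _] := not_dirs g s.
    have {}r : rt f (h - m) y.
      case/orP: r => // /L[u [_ r]].
      by have := anti_even eN hi; rewrite -/y u r.
    have sh : sq 0 (N - 1) (h + 1) h by zlia.
    have u : up f (h + 1) h by rewrite (dn_up _ _ (erefl (h + 1)%Z)).
    have [Uh _ _ _] := not_dirs g sh; have [_ [_ nr]] := Uh u.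
    have nr' : ~~ rt f (h + 1) (N - 1 - (h + 1)).
      by have -> : (N - 1 - (h + 1) = h)%Z; [zlia|rewrite nr].
    have [|z [hz dz nz]] := @switch (fun z => rt f z (N - 1 - z)) (h - m)%Z (h + 1)%Z _ r nr'.
      by zlia.
    have rz : up f (z + 1) (N - 1 - z - 1).
      have := anti_even (i := (z + 1)%Z) eN; rewrite (negbTE nz) orbF => H.
      by apply: eq_up (H _); zlia.
    exists (N - 2 - 2 * z)%Z; split; first by zlia.
    left; exists (h - z)%Z; split; first by zlia.
    move=> i j sij; have [||h1 h2] := chordB3 g _ _ dz rz sij; [zlia|zlia|].
    by split=> ?; [apply: h2|apply: h1]; zlia.
- rewrite (even_double1 e); case: hN => eN.
  + rewrite (@half_odd _ (h + 1 + m)%Z); last by zlia.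
    have hi : (0 <= h + 1 + m <= N - 1)%Z by zlia.
    set y := (N - 1 - (h + 1 + m))%Z => r.
    have s : sq 0 (N - 1) (h + 1 + m) y by zlia.
    have [_ _ L R] := not_dirs g s.
    have nd : ~~ dn f (h + 1 + m) y.
      by case/orP: r => [/L[_ [->]]|/R[_ [->]]].
    have b' : dn f h (N - 1 - h) by apply: eq_dn base; zlia.
    have [|z [hz dz nz]] := @switch (fun z => dn f z (N - 1 - z)) h (h + 1 + m)%Z _ b' nd.
      by zlia.
    have rz : lf f (z + 1) (N - 1 - z - 1).
      have := anti_odd (i := (z + 1)%Z) eN; rewrite (negbTE nz) => H.
      by apply: eq_lf (H _); zlia.
    exists (2 * z + 1 - 2 * h)%Z; split; first by zlia.
    right; exists (z - h)%Z; split; first by zlia.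
    move=> i j sij; have [||h1 h2] := chordB1 g _ _ dz rz sij; [zlia|zlia|].
    by split=> ?; [apply: h1|apply: h2]; zlia.
  + rewrite (@half_even _ (h + 2 + m)%Z); last by zlia.
    have hi : (0 <= h + 2 + m <= N - 1)%Z by zlia.
    set y := (N - 1 - (h + 2 + m))%Z => r.
    have s : sq 0 (N - 1) (h + 2 + m) y by zlia.
    have [_ _ L R] := not_dirs g s.
    have nd : ~~ up f (h + 2 + m) y.
      by case/orP: r => [/L[->]|/R[->]].
    have b' : up f (h + 1) (N - 1 - (h + 1)).
      by have -> : (N - 1 - (h + 1) = h)%Z; [zlia|rewrite (dn_up _ _ (erefl (h + 1)%Z))].
    have [|z [hz dz nz]] := @switch (fun z => up f z (N - 1 - z)) (h + 1)%Z (h + 2 + m)%Z _ b' nd.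
      by zlia.
    have rz : rt f (z + 1) (N - 1 - z - 1).
      have := anti_even (i := (z + 1)%Z) eN; rewrite (negbTE nz) => H.
      by apply: eq_rt (H _); zlia.
    exists (2 * z - 2 * h - 1)%Z; split; first by zlia.
    right; exists (z - h - 1)%Z; split; first by zlia.
    move=> i j sij; have [||h1 h2] := chordB4 g _ _ dz rz sij; [zlia|zlia|].
    by split=> ?; [apply: h1|apply: h2]; zlia.
Qed.

(* Two crossing chords would give some vertex two different directions. *)
Lemma readAB k l : readA k -> readB l -> (N - 1 <= k + l)%Z.
Proof.
move=> /chord_of_A[k0 [hk cA]] /chord_of_B[l0 [hl cB]].
have [//|kl] : (N - 1 <= k + l \/ k0 + l0 <= N - 2)%Z by zlia.
exfalso; move: cA cB => [[m [ek H]]|[m [ek H]]] [[m' [el H']]|[m' [el H']]].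
(* The point solves the equations for i + j and j - i of one line from each chord, chosen with
   compatible parities; it is in the square since k0 + l0 <= N - 2. *)
- have s : sq 0 (N - 1) (N - 1 + m - m') (N + m + m') by zlia.
  have [h1 _] := H _ _ s; have [_ h2] := H' _ _ s.
  have [U _ _ _] := not_dirs g s; have [_ [_ U3]] := U (h1 ltac:(zlia)).
  by rewrite h2 in U3; last by zlia.
- have s : sq 0 (N - 1) (N + m + m' + 1) (N + m - m' - 1) by zlia.
  have [_ h1] := H _ _ s; have [_ h2] := H' _ _ s.
  have [_ _ _ U] := not_dirs g s; have [_ [_ U3]] := U (h1 ltac:(zlia)).
  by rewrite h2 in U3; last by zlia.
- have s : sq 0 (N - 1) (-2 - m - m') (-1 - m + m') by zlia.
  have [_ h1] := H _ _ s; have [_ h2] := H' _ _ s.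
  have [_ _ U _] := not_dirs g s; have [_ [_ U3]] := U (h1 ltac:(zlia)).
  by rewrite h2 in U3; last by zlia.
- have s : sq 0 (N - 1) (m' - m) (-2 - m - m') by zlia.
  have [h1 _] := H _ _ s; have [_ h2] := H' _ _ s.
  have [_ U _ _] := not_dirs g s; have [_ [U3 _]] := U (h1 ltac:(zlia)).
  by rewrite h2 in U3; last by zlia.
Qed.

End Extract.

Section Recover.
Variables (N h : Z) (f : field).
Hypotheses (hN : (N = 2 * h + 1 \/ N = 2 * h + 2)%Z) (h0 : (0 <= h)%Z).
Hypotheses (g : good 0 (N - 1) f) (base : dn f h h).

Notation A := (readA N f).
Notation B := (readB N f).

Lemma readA_row k : (0 <= k < N - 1)%Z -> A k = rt f (rowA N k) (rowA N k).
Proof. by case=> /Z.leb_le k1 /Z.ltb_lt k2; rewrite /readA k1 k2. Qed.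

Lemma readB_row l : (0 <= l < N - 1)%Z ->
  B l = lf f (rowB N l) (N - 1 - rowB N l) || rt f (rowB N l) (N - 1 - rowB N l).
Proof. by case=> /Z.leb_le k1 /Z.ltb_lt k2; rewrite /readB k1 k2. Qed.

Lemma flipA_main i : (0 <= i <= N - 1)%Z -> flipA N A i i = rt f i i.
Proof.
move=> hi; rewrite /flipA /levelA (@even_double (i + i) i); last by lia.
case: Z.ltb_spec => hz.
  rewrite readA_row; last by lia.
  rewrite /rowA (@even_double _ (i - N)); last by lia.
  by rewrite (@half_even _ i) //; lia.
have [e|ih] : (i = h \/ i < h)%Z by lia.
  rewrite e (A_neg (@readA_range N f)); last by lia.
  have s : sq 0 (N - 1) h h by sqlia.
  by have [_ D _ _] := not_dirs g s; have [_ [_ ->]] := D base.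
rewrite readA_row; last by lia.
rewrite /rowA (@even_double1 _ (- 2 - i)); last by lia.
by rewrite (@half_even _ i) //; lia.
Qed.

Lemma flipB_main i : flipB B i i = false.
Proof.
rewrite /flipB /levelB (@even_double (i + i) i); last by lia.
by case: Z.ltb_spec => hz; apply: (B_neg (@readB_range N f)); lia.
Qed.

Lemma flipA_anti i : flipA N A i (N - 1 - i) = false.
Proof.
rewrite /flipA /levelA; apply: (A_neg (@readA_range N f)).
by case: Z.ltb_spec => hz; case: Z.even; lia.
Qed.

Lemma flipB_anti i : (0 <= i <= N - 1)%Z ->
  flipB B i (N - 1 - i) = lf f i (N - 1 - i) || rt f i (N - 1 - i).
Proof.
move=> hi; rewrite /flipB /levelB; case: hN => eN.
  rewrite (@even_double (i + (N - 1 - i)) h); last by lia.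
  case: Z.ltb_spec => hz.
    rewrite readB_row; last by lia.
    rewrite /rowB (@even_double _ (h - 1 - i)); last by lia.
    by rewrite (@half_odd _ i) //; lia.
  have [e|ih] : (i = h \/ h < i)%Z by lia.
    rewrite e (B_neg (@readB_range N f)); last by lia.
    have s : sq 0 (N - 1) h h by sqlia.
    have -> : (N - 1 - h = h)%Z by lia.
    by have [_ D _ _] := not_dirs g s; have [_ [-> ->]] := D base.
  rewrite readB_row; last by lia.
  rewrite /rowB (@even_double1 _ (i - h - 1)); last by lia.
  by rewrite (@half_odd _ i) //; lia.
rewrite (@even_double1 (i + (N - 1 - i)) h); last by lia.
case: Z.ltb_spec => hz.
  rewrite readB_row; last by lia.
  rewrite /rowB (@even_double _ (h - i)); last by lia.
  by rewrite (@half_even _ i) //; lia.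
have [e|ih] : (i = h + 1 \/ h + 1 < i)%Z by lia.
  rewrite e (B_neg (@readB_range N f)); last by lia.
  have s : sq 0 (N - 1) (h + 1) h by sqlia.
  have u : up f (h + 1) h by rewrite (dn_up _ _ (erefl (h + 1)%Z)).
  have -> : (N - 1 - (h + 1) = h)%Z by lia.
  by have [U _ _ _] := not_dirs g s; have [_ [-> ->]] := U u.
rewrite readB_row; last by lia.
rewrite /rowB (@even_double1 _ (i - h - 2)); last by lia.
by rewrite (@half_even _ i) //; lia.
Qed.

(** Both fields are good, so comparing them on the two diagonals is enough. On the main diagonal
    only A can be flipped, on the antidiagonal only B. *)
Theorem recover i j : sq 0 (N - 1) i j -> same f (phi N A B) i j.
Proof.
have rA := @readA_range N f. have rB := @readB_range N f.
have AB := readAB hN h0 g base.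
have eN : (N - 1 = 0 +z (Z.to_nat N) - 1)%Z by lia.
apply: (diagonals_determine eN g (good_phi rA rB AB)) => k hi; move: k hi => {}i hi.
have i0 : (0 + (N - 1) - i = N - 1 - i)%Z by lia.
have iE : insideb N i i by rewrite /insideb; lia.
have iE' : insideb N i (N - 1 - i) by rewrite /insideb; lia.
rewrite i0 /same !up_phi // !dn_phi // !lf_phi // !rt_phi //.
have s : sq 0 (N - 1) i i by sqlia.
have s' : sq 0 (N - 1) i (N - 1 - i) by sqlia.
rewrite /dir_up /dir_dn /dir_lf /dir_rt flipB_main flipA_anti flipA_main // flipB_anti //.
split.
- rewrite /par (@even_double (i + i) i); last by lia.
  have := main_dn_rt hN h0 g base hi.
  have [_ _ _] := good_dirs g s; have [_] := good_dirs g s.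
  by case: (up f i i); case: (dn f i i); case: (lf f i i); case: (rt f i i).
- have [_] := good_dirs g s'.
  case: hN => eN'.
    have := anti_odd hN h0 g base eN' hi.
    rewrite /par (@even_double (i + (N - 1 - i)) h); last by lia.
    by case: (up f i (N - 1 - i)); case: (dn f i (N - 1 - i)); case: (lf f i (N - 1 - i));
       case: (rt f i (N - 1 - i)).
  have := anti_even hN h0 g base eN' hi.
  rewrite /par (@even_double1 (i + (N - 1 - i)) h); last by lia.
  by case: (up f i (N - 1 - i)); case: (dn f i (N - 1 - i)); case: (lf f i (N - 1 - i));
     case: (rt f i (N - 1 - i)).
Qed.

End Recover.

(** * Coding by words *)

(* The letter p of a word is [Some true] when strip p of A is flipped and
   [Some false] when strip M - 1 - p of B is; the latter all come first. *)
Fixpoint words_noB M : seq (seq (option bool)) := if M is m.+1 then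
  [seq None :: w | w <- words_noB m] ++ [seq Some true :: w | w <- words_noB m] else [:: [::]].

Fixpoint words M : seq (seq (option bool)) := if M is m.+1 then
  [seq None :: w | w <- words m] ++ [seq Some false :: w | w <- words m] ++
  [seq Some true :: w | w <- words_noB m] else [:: [::]].

Lemma size_words_noB M : size (words_noB M) = 2 ^ M.
Proof. by elim: M => //= M IH; rewrite size_cat !size_map IH expnS; lia. Qed.

(** Doubled, so that (M + 2) * 2 ^ (M - 1) makes sense for M = 0 too. *)
Lemma size_words M : 2 * size (words M) = (M + 2) * 2 ^ M.
Proof.
elim: M => //= M IH; rewrite !size_cat !size_map size_words_noB expnS; nia.
Qed.

Lemma cons_inj (T : Type) (x : T) : injective (cons x).
Proof. by move=> s t []. Qed.

Lemma mem_cons_map (x y : option bool) w (s : seq (seq (option bool))) :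
  (x :: w \in [seq y :: u | u <- s]) = (x == y) && (w \in s).
Proof.
apply/mapP/andP => [[u hu [-> ->]]|[/eqP-> h]]; first by rewrite eqxx.
by exists w.
Qed.

Lemma nil_cons_map (y : option bool) (s : seq (seq (option bool))) :
  ([::] \in [seq y :: u | u <- s]) = false.
Proof. by apply/mapP => [[]]. Qed.

Lemma mem_words_noB M w :
  (w \in words_noB M) = (size w == M) && (Some false \notin w).
Proof.
elim: M w => [|M IH] [|x w] //=; rewrite mem_cat ?nil_cons_map ?mem_cons_map //.
by rewrite !IH eqSS inE; case: x => [[]|]; rewrite //= ?andbF ?orbF.
Qed.

Lemma mem_words M w : (w \in words M) = (size w == M) &&
  pairwise (fun x y => (x == Some true) ==> (y != Some false)) w.
Proof.
elim: M w => [|M IH] [|x w] //=; rewrite !mem_cat ?nil_cons_map ?mem_cons_map //.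
rewrite IH mem_words_noB eqSS; case: x => [[]|] //=; rewrite ?orbF ?andbT ?all_predT //=.
congr andb; rewrite -[Some false \notin w]andbT.
have -> : all (fun y => y != Some false) w = (Some false \notin w).
  by rewrite -has_pred1 -all_predC; apply: eq_all.
by case E: (_ \notin w) => //=; elim: w E {IH} => //= y w IHw; rewrite inE negb_or
  => /andP[h /[dup] h' /IHw <-]; rewrite andbT; apply/esym/allP => z hz;
  apply/implyP => _; apply/eqP => e; rewrite e in hz; rewrite hz in h'.
Qed.

Lemma uniq_words_noB M : uniq (words_noB M).
Proof.
elim: M => //= M IH; rewrite cat_uniq !map_inj_uniq ?IH; try exact: cons_inj.
by rewrite andbT /=; apply/hasPn => _ /mapP[u _ ->]; rewrite mem_cons_map.
Qed.

Lemma uniq_words M : uniq (words M).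
Proof.
elim: M => //= M IH; rewrite !cat_uniq !map_inj_uniq ?IH ?uniq_words_noB; try exact: cons_inj.
rewrite andbT /=; apply/andP; split.
  by apply/hasPn => s; rewrite mem_cat => /orP[] /mapP[u _ ->]; rewrite mem_cons_map.
by apply/hasPn => _ /mapP[u _ ->]; rewrite mem_cons_map.
Qed.

Section Coding.
Variable M : nat.
Let N := (Z.of_nat M + 1)%Z.
Let h := (Z.of_nat (M./2)).

Let hN : (N = 2 * h + 1 \/ N = 2 * h + 2)%Z.
Proof. by rewrite /N /h; lia. Qed.
Let h0 : (0 <= h)%Z.
Proof. by rewrite /h; lia. Qed.

Definition wordA (w : seq (option bool)) k :=
  [&& (0 <=? k)%Z, (k <? N - 1)%Z & nth None w (Z.to_nat k) == Some true].
Definition wordB (w : seq (option bool)) l :=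
  [&& (0 <=? l)%Z, (l <? N - 1)%Z & nth None w (Z.to_nat (N - 2 - l)) == Some false].

Lemma wordA_range w k : wordA w k -> (0 <= k < N - 1)%Z.
Proof. by case/and3P => /Z.leb_le ? /Z.ltb_lt ? _. Qed.
Lemma wordB_range w k : wordB w k -> (0 <= k < N - 1)%Z.
Proof. by case/and3P => /Z.leb_le ? /Z.ltb_lt ? _. Qed.

(** Strip l of B is letter N - 2 - l, so N - 1 <= k + l says that this letter comes strictly before
    letter k. *)
Lemma words_AB w k l : w \in words M -> wordA w k -> wordB w l -> (N - 1 <= k + l)%Z.
Proof.
rewrite mem_words => /andP[/eqP sz pw] a b.
have := wordA_range a; have := wordB_range b.
case/and3P: a => _ _ a; case/and3P: b => _ _ b hl hk.
have [//|kl] : (N - 1 <= k + l \/ k + l < N - 1)%Z by lia.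
have [e|lt] : (Z.to_nat k = Z.to_nat (N - 2 - l) \/ (Z.to_nat k < Z.to_nat (N - 2 - l)))%N.
  by move: hl hk kl; clear; lia.
  by move: a b; rewrite e => /eqP-> .
move/(pairwiseP None): pw => /(_ (Z.to_nat k) (Z.to_nat (N - 2 - l))).
rewrite !inE sz a /= b => H; have : false; last by [].
by apply: H => //; move: hl hk; clear; rewrite /N; lia.
Qed.

Definition word_of (A B : Z -> bool) : seq (option bool) :=
  mkseq (fun p => if A (Z.of_nat p) then Some true
                  else if B (N - 2 - Z.of_nat p)%Z then Some false else None) M.

Lemma word_of_words (A B : Z -> bool) : (forall k l, A k -> B l -> (N - 1 <= k + l)%Z) ->
  word_of A B \in words M.
Proof.
move=> AB; rewrite mem_words size_mkseq eqxx /=; apply/(pairwiseP None) => p q.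
rewrite !inE size_mkseq => hp hq pq; rewrite !nth_mkseq //.
case a: (A _); last by case: (B _).
case: (A (Z.of_nat q)) => //; case b: (B _) => //=.
by have := AB _ _ a b; move: pq hp hq; clear; rewrite /N; lia.
Qed.

Lemma wordA_word_of (A B : Z -> bool) k : (forall k, A k -> (0 <= k < N - 1)%Z) ->
  wordA (word_of A B) k = A k.
Proof.
move=> rA; rewrite /wordA.
case: Z.leb_spec => k0 /=; last by apply/esym/negP => /rA; lia.
case: Z.ltb_spec => k1 /=; last by apply/esym/negP => /rA; lia.
rewrite nth_mkseq; last by move: k0 k1; clear; rewrite /N; lia.
by rewrite Z2Nat.id //; case: (A k) => //; case: (B _).
Qed.

Lemma wordB_word_of (A B : Z -> bool) l : (forall k l, A k -> B l -> (N - 1 <= k + l)%Z) ->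
  (forall k, B k -> (0 <= k < N - 1)%Z) -> wordB (word_of A B) l = B l.
Proof.
move=> AB rB; rewrite /wordB.
case: Z.leb_spec => k0 /=; last by apply/esym/negP => /rB; lia.
case: Z.ltb_spec => k1 /=; last by apply/esym/negP => /rB; lia.
rewrite nth_mkseq; last by move: k0 k1; clear; rewrite /N; lia.
rewrite Z2Nat.id; last by lia.
have -> : (N - 2 - (N - 2 - l) = l)%Z by lia.
case a: (A _) => /=; last by case: (B l).
by apply/esym/negP => b; have := AB _ _ a b; lia.
Qed.

Definition code w := phi N (wordA w) (wordB w).

Lemma good_code w : w \in words M -> good 0 (N - 1) (code w).
Proof.
move=> hw; apply: good_phi; [exact: wordA_range|exact: wordB_range|].
by move=> k l; apply: words_AB.
Qed.

Lemma levelA_row k : (0 <= k < N - 1)%Z ->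
  levelA N (rowA N k) (rowA N k) = k /\ (0 <= rowA N k <= N - 1)%Z.
Proof.
move=> hk; rewrite /rowA; have [m [e|e]] := parity (k - N).
  rewrite (even_double e) (@half_even _ (N + m)%Z); last by lia.
  rewrite /levelA (@even_double _ (N + m)); last by lia.
  by case: Z.ltb_spec; lia.
rewrite (even_double1 e) (@half_even _ (-2 - m)%Z); last by lia.
rewrite /levelA (@even_double _ (-2 - m)); last by lia.
by case: Z.ltb_spec; lia.
Qed.

Lemma levelB_row l : (0 <= l < N - 1)%Z ->
  levelB (rowB N l) (N - 1 - rowB N l) = l /\ (0 <= rowB N l <= N - 1)%Z.
Proof.
move=> hl; rewrite /rowB; have [m [e|e]] := parity l.
  rewrite (even_double e) /levelB; case: hN => eN.
    rewrite (@half_odd _ (h - 1 - m)%Z); last by lia.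
    rewrite (@even_double _ h); last by lia.
    by case: Z.ltb_spec; lia.
  rewrite (@half_even _ (h - m)%Z); last by lia.
  rewrite (@even_double1 _ h); last by lia.
  by case: Z.ltb_spec; lia.
rewrite (even_double1 e) /levelB; case: hN => eN.
  rewrite (@half_odd _ (h + 1 + m)%Z); last by lia.
  rewrite (@even_double _ h); last by lia.
  by case: Z.ltb_spec; lia.
rewrite (@half_even _ (h + 2 + m)%Z); last by lia.
rewrite (@even_double1 _ h); last by lia.
by case: Z.ltb_spec; lia.
Qed.

Lemma code_wordA w k : (0 <= k < N - 1)%Z ->
  wordA w k = rt (code w) (rowA N k) (rowA N k).
Proof.
move=> hk; have [e r] := levelA_row hk.
rewrite rt_phi; [|exact: wordA_range|exact: wordB_range|by rewrite /insideb; lia].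
rewrite /dir_rt /flipA e /par (@even_double _ (rowA N k)); last by lia.
by rewrite andbT andbF orbF.
Qed.

Lemma code_wordB w l : w \in words M -> (0 <= l < N - 1)%Z ->
  wordB w l = lf (code w) (rowB N l) (N - 1 - rowB N l)
           || rt (code w) (rowB N l) (N - 1 - rowB N l).
Proof.
move=> hw hk; have [e r] := levelB_row hk.
have s : insideb N (rowB N l) (N - 1 - rowB N l) by rewrite /insideb; lia.
rewrite lf_phi ?rt_phi //; try exact: wordA_range; try exact: wordB_range.
rewrite /dir_lf /dir_rt /flipB e.
have -> : flipA N (wordA w) (rowB N l) (N - 1 - rowB N l) = false.
  apply: (A_neg (@wordA_range w)); rewrite /levelA.
  by case: Z.ltb_spec => hz; case: Z.even; lia.
by case: (par _ _); case: (wordB w l).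
Qed.

Lemma code_base w : dn (code w) h h.
Proof.
rewrite dn_phi; [|exact: wordA_range|exact: wordB_range|by rewrite /insideb; lia].
rewrite /dir_dn /par (@even_double _ h); last by lia.
rewrite /flipA (A_neg (@wordA_range w)) ?/flipB ?(B_neg (@wordB_range w)) //.
  by rewrite /levelB (@even_double _ h); [case: Z.ltb_spec; lia|lia].
by rewrite /levelA (@even_double _ h); [case: Z.ltb_spec; lia|lia].
Qed.

Definition agree f g := forall i j, sq 0 (N - 1) i j -> same f g i j.

Lemma code_inj w w' : w \in words M -> w' \in words M -> agree (code w) (code w') -> w = w'.
Proof.
move=> hw hw' ag.
have eA k : (0 <= k < N - 1)%Z -> wordA w k = wordA w' k.
  move=> hk; have [_ r] := levelA_row hk; rewrite !code_wordA //.
  by have [] := ag (rowA N k) (rowA N k) ltac:(sqlia).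
have eB k : (0 <= k < N - 1)%Z -> wordB w k = wordB w' k.
  move=> hk; have [_ r] := levelB_row hk; rewrite !code_wordB //.
  by have [_ _ -> ->] := ag (rowB N k) (N - 1 - rowB N k)%Z ltac:(sqlia).
move: hw hw'; rewrite !mem_words => /andP[/eqP sz _] /andP[/eqP sz' _].
apply: (@eq_from_nth _ None); first by rewrite sz sz'.
move=> p; rewrite sz => hp.
have rp : (0 <= Z.of_nat p < N - 1)%Z by rewrite /N; lia.
have rp' : (0 <= N - 2 - Z.of_nat p < N - 1)%Z by rewrite /N; lia.
move: (eA _ rp) (eB _ rp'); rewrite /wordA /wordB.
case: rp => /Z.leb_le-> /Z.ltb_lt->; case: rp' => /Z.leb_le-> /Z.ltb_lt->.
have -> : (N - 2 - (N - 2 - Z.of_nat p) = Z.of_nat p)%Z by lia.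
rewrite Nat2Z.id.
by case: (nth None w p) => [[]|]; case: (nth None w' p) => [[]|].
Qed.

Lemma code_surj f : good 0 (N - 1) f -> dn f h h ->
  exists2 w, w \in words M & agree f (code w).
Proof.
move=> g base; exists (word_of (readA N f) (readB N f)).
  by apply: word_of_words; exact: readAB hN h0 g base.
move=> i j s; have := recover hN h0 g base s; congr (same f _ i j).
have AB := readAB hN h0 g base.
by rewrite /code; congr phi; apply: functional_extensionality => k; apply/esym;
  [apply: wordA_word_of => l; apply: readA_range|
   apply: wordB_word_of => // l; apply: readB_range].
Qed.

Definition half_turn f := vflip (N - 1) (hflip (N - 1) f).
(** The two bits generate a group of four involutions, which carries the four directions at the
    centre into each other. *)
Definition sym (c : bool * bool) f :=
  let f' := if c.2 then half_turn f else f in if c.1 then tr f' else f'.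

Lemma half_turnK : involutive half_turn.
Proof. by move=> f; apply: field_ext => i j /=; f_equal; lia. Qed.

Lemma tr_half_turn f : tr (half_turn f) = half_turn (tr f).
Proof. by apply: field_ext => i j /=; f_equal; lia. Qed.

Lemma symK c : involutive (sym c).
Proof.
by case: c => [[] []] f; rewrite /sym /= ?tr_half_turn ?half_turnK ?trK // tr_half_turn half_turnK.
Qed.

Lemma good_half_turn f : good 0 (N - 1) f -> good 0 (N - 1) (half_turn f).
Proof. by move=> g; have := good_vflip (good_hflip g); rewrite Z.add_0_l. Qed.

Lemma good_sym c f : good 0 (N - 1) f -> good 0 (N - 1) (sym c f).
Proof.
move=> g; have g' := good_half_turn g.
by case: c => [[] []] //; [exact: (good_tr g')|exact: (good_tr g)].
Qed.

Lemma agree_tr f g : agree f g -> agree (tr f) (tr g).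
Proof. by move=> ag i j s; have := ag j i; rewrite /same !accE => H; case: H => //; sqlia. Qed.

Lemma agree_half_turn f g : agree f g -> agree (half_turn f) (half_turn g).
Proof.
move=> ag i j s; have := ag (N - 1 - i)%Z (N - 1 - j)%Z.
by rewrite /same /half_turn !vflipE !accE => H; case: H => //; sqlia.
Qed.

Lemma agree_sym c f g : agree f g -> agree (sym c f) (sym c g).
Proof.
move=> ag; have ag' := agree_half_turn ag.
by case: c => [[] []] //; [exact: (agree_tr ag')|exact: (agree_tr ag)].
Qed.

Lemma sym_base c f : dn (sym c f) h h = match c with
  | (false, false) => dn f h h
  | (true, false) => rt f h h
  | (false, true) => up f (N - 1 - h) (N - 1 - h)
  | (true, true) => lf f (N - 1 - h) (N - 1 - h)
  end.
Proof.
case: c => [[] []].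
- by rewrite -[sym _ _]/(tr (half_turn f)) dn_tr /half_turn rt_vflip rt_hflip.
- by rewrite -[sym _ _]/(tr f) dn_tr.
- by rewrite -[sym _ _]/(half_turn f) /half_turn dn_vflip up_hflip.
- by [].
Qed.

Lemma sym_base_ex f : good 0 (N - 1) f -> exists c, dn (sym c f) h h.
Proof.
move=> g; case E: (dn f h h || rt f h h).
  by case/orP: E => e; [exists (false, false)|exists (true, false)]; rewrite sym_base.
have s1 : sq 0 (N - 1) h h by sqlia.
have s2 : sq 0 (N - 1) (N - 1 - h) (N - 1 - h) by sqlia.
rewrite (main_diag g s1 s2) in E.
have [ex _ _ _] := good_dirs g s2.
move/negbT: E; rewrite negb_or => /andP[/negbTE d /negbTE r].
by move: ex; rewrite d r orbF /= => /orP[e|e]; [exists (false, true)|exists (true, true)];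
  rewrite sym_base.
Qed.

(** By [main_diag] the points h and N - 1 - h are both in {[dn], [rt]} or both in {[up], [lf]},
    which fixes the half-turn bit; the single direction of a point then fixes the other bit. *)
Lemma sym_base_inj f c c' : good 0 (N - 1) f ->
  dn (sym c f) h h -> dn (sym c' f) h h -> c = c'.
Proof.
move=> g.
have s1 : sq 0 (N - 1) h h by sqlia.
have s2 : sq 0 (N - 1) (N - 1 - h) (N - 1 - h) by sqlia.
have [_ D1 _ R1] := not_dirs g s1; have [U2 _ L2 _] := not_dirs g s2.
have k x : dn (sym x f) h h -> (dn f h h || rt f h h) = ~~ x.2.
  rewrite sym_base; case: x => [[] []] /= e; rewrite ?e ?orbT //;
    rewrite (main_diag g s1 s2); [case: (L2 e)|case: (U2 e)] => _ [].
    by move=> -> ->.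
  by move=> d1; have [d2 [_ ->]] := U2 e; rewrite d2.
move=> h1 h2; have e := k _ h1; rewrite (k _ h2) in e.
move: h1 h2 e; rewrite !sym_base; case: c => [[] []]; case: c' => [[] []] //= h1 h2 _.
- by have [u _] := L2 h1; rewrite h2 in u.
- by have [_ [d _]] := R1 h1; rewrite h2 in d.
- by have [u _] := L2 h2; rewrite h1 in u.
- by have [_ [d _]] := R1 h2; rewrite h1 in d.
Qed.

Theorem sym_code_surj f : good 0 (N - 1) f ->
  exists c, exists2 w, w \in words M & agree f (sym c (code w)).
Proof.
move=> g; have [c bc] := sym_base_ex g.
have [w hw ag] := code_surj (good_sym c g) bc.
by exists c, w => //; have := agree_sym c ag; rewrite symK.
Qed.

Theorem sym_code_inj c w c' w' : w \in words M -> w' \in words M ->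
  agree (sym c (code w)) (sym c' (code w')) -> (c, w) = (c', w').
Proof.
move=> hw hw' ag.
have e : c = c'.
  apply: (@sym_base_inj (sym c (code w))); first exact/good_sym/good_code.
    by rewrite symK; exact: code_base.
  have ag' := agree_sym c' ag; rewrite symK in ag'.
  by have [|_ -> _ _] := ag' h h; [sqlia|exact: code_base].
rewrite -e in ag *; congr pair; apply: code_inj => //.
by have := agree_sym c ag; rewrite !symK.
Qed.

End Coding.

(** * Tilings as fields *)

Section Tilings.
Variable K : nat.
Notation cel := (cell K.+1 K.+1).
Implicit Types (x y z : cel) (P : {set {set cel}}) (f : field).

Definition row x := Z.of_nat x.1.
Definition col x := Z.of_nat x.2.

Definition at_ (i j : Z) : cel := (inord (Z.to_nat i), inord (Z.to_nat j)).

Lemma row_at i j : (0 <= i <= Z.of_nat K)%Z -> row (at_ i j) = i.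
Proof. by move=> h; rewrite /row /col /at_ /= inordK; lia. Qed.
Lemma col_at i j : (0 <= j <= Z.of_nat K)%Z -> col (at_ i j) = j.
Proof. by move=> h; rewrite /row /col /at_ /= inordK; lia. Qed.
Lemma atE x : at_ (row x) (col x) = x.
Proof. by case: x => a b; rewrite /row /col /at_ /= !Nat2Z.id !inord_val. Qed.

Lemma row_bound x : (0 <= row x <= Z.of_nat K)%Z.
Proof. by rewrite /row; have := ltn_ord x.1; lia. Qed.
Lemma col_bound x : (0 <= col x <= Z.of_nat K)%Z.
Proof. by rewrite /col; have := ltn_ord x.2; lia. Qed.

Lemma cell_eq x y : row x = row y -> col x = col y -> x = y.
Proof. by move=> h1 h2; rewrite -(atE x) -(atE y) h1 h2. Qed.

(** The range tests are essential: [at_] sends indices outside the grid to a default cell. *)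
Definition field_of P := Field
  (fun i j => [&& 0 <=? i, i <=? Z.of_nat K, 0 <=? j & j <? Z.of_nat K]%Z
              && (pblock P (at_ i j) == pblock P (at_ i (j + 1))))
  (fun i j => [&& 0 <=? i, i <? Z.of_nat K, 0 <=? j & j <=? Z.of_nat K]%Z
              && (pblock P (at_ i j) == pblock P (at_ (i + 1) j))).

Definition joined f x y : Prop :=
  [\/ [/\ row y = row x, col y = col x + 1 & eh f (row x) (col x)],
      [/\ row y = row x, col x = col y + 1 & eh f (row y) (col y)],
      [/\ col y = col x, row y = row x + 1 & ev f (row x) (col x)] |
      [/\ col y = col x, row x = row y + 1 & ev f (row y) (col y)]]%Z.

Lemma joined_sym f x y : joined f x y -> joined f y x.
Proof.
case=> [[a b c]|[a b c]|[a b c]|[a b c]].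
- by apply: Or42; split.
- by apply: Or41; split.
- by apply: Or44; split.
- by apply: Or43; split.
Qed.

Lemma joined_uniq f x y z : matching f -> joined f x y -> joined f x z -> y = z.
Proof.
case=> H V X [[a b c]|[a b c]|[a b c]|[a b c]] [[a' b' c']|[a' b' c']|[a' b' c']|[a' b' c']];
  try (by apply: cell_eq; lia); exfalso.
- by rewrite -a' in c; apply: (H _ _ _ _ c' c); lia.
- by apply: (X _ _ _ _ _ _ c c'); lia.
- by apply: (X _ _ _ _ _ _ c c'); lia.
- by rewrite a in c; apply: (H _ _ _ _ c c'); lia.
- by apply: (X _ _ _ _ _ _ c c'); lia.
- by apply: (X _ _ _ _ _ _ c c'); lia.
- by apply: (X _ _ _ _ _ _ c' c); lia.
- by apply: (X _ _ _ _ _ _ c' c); lia.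
- by rewrite -a' in c; apply: (V _ _ _ _ c' c); lia.
- by apply: (X _ _ _ _ _ _ c' c); lia.
- by apply: (X _ _ _ _ _ _ c' c); lia.
- by rewrite a in c; apply: (V _ _ _ _ c c'); lia.
Qed.

Lemma adjacentP x y : reflect
  ((row x = row y /\ (col y = col x + 1 \/ col x = col y + 1)) \/
   (col x = col y /\ (row y = row x + 1 \/ row x = row y + 1)))%Z (adjacent x y).
Proof. by apply: (iffP idP); rewrite /adjacent /row /col; lia. Qed.

Lemma joined_adjacent f x y : joined f x y -> adjacent x y.
Proof. by move=> h; apply/adjacentP; case: h => [[]|[]|[]|[]]; lia. Qed.

Section OfTiling.
Variable P : {set {set cel}}.
Hypothesis tP : mono_dimer_tiling P.

Let part : partition P [set: cel]. Proof. by case/andP: tP. Qed.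
Let cov : cover P = [set: cel]. Proof. by case/and3P: part => /eqP. Qed.
Let triv : trivIset P. Proof. by case/and3P: part. Qed.

Lemma in_pblock x : x \in pblock P x.
Proof. by rewrite mem_pblock cov inE. Qed.

Lemma pblock_tile x : pblock P x \in P.
Proof. by apply: pblock_mem; rewrite cov inE. Qed.

Lemma pblock_shape x : is_monomer (pblock P x) || is_dimer (pblock P x).
Proof. by case/andP: tP => _ /forallP /(_ (pblock P x)); rewrite pblock_tile. Qed.

Lemma same_block x y : (pblock P x == pblock P y) = (y \in pblock P x).
Proof.
apply/eqP/idP => [->|h]; first exact: in_pblock.
by rewrite (same_pblock triv h).
Qed.

Lemma block_adjacent x y : x != y -> pblock P x == pblock P y -> adjacent x y.
Proof.
move=> xy; rewrite same_block => hy; have hx := in_pblock x.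
case/orP: (pblock_shape x).
  move/cards1P=> [u e]; move: hx hy xy; rewrite e !inE => /eqP-> /eqP->.
  by rewrite eqxx.
case/existsP=> u /existsP[v /andP[/eqP e /adjacentP ad]].
move: hx hy xy; rewrite e !inE => /orP[]/eqP-> /orP[]/eqP->; rewrite ?eqxx // => _.
  exact/adjacentP.
by apply/adjacentP; lia.
Qed.

Lemma block_two x y z : x != y -> x != z -> y != z ->
  pblock P x == pblock P y -> pblock P x == pblock P z -> False.
Proof.
move=> xy xz yz; rewrite !same_block => hy hz; have hx := in_pblock x.
have h3 : 3 <= #|pblock P x|.
  have <- : #|[set x; y; z]| = 3.
    by rewrite setUC cardsU1 cards2 !inE xy eq_sym (negbTE xz) eq_sym (negbTE yz).
  by apply: subset_leq_card; apply/subsetP => u; rewrite !inE => /orP[/orP[]|] /eqP->.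
case/orP: (pblock_shape x) => [/eqP e|]; first by rewrite e in h3.
case/existsP=> u /existsP[v /andP[/eqP e _]].
by move: h3; rewrite e cards2; case: (u != v).
Qed.

Lemma joined_block x y : x != y -> pblock P x == pblock P y -> joined (field_of P) x y.
Proof.
move=> xy e; have := row_bound x; have := row_bound y; have := col_bound x; have := col_bound y.
case/adjacentP: (block_adjacent xy e) => [[a [b|b]]|[a [b|b]]] c1 c2 c3 c4.
- apply: Or41; split=> //=; rewrite -b [X in at_ X (col y)]a !atE e andbT; lia.
- apply: Or42; split=> //=; rewrite -b -[X in at_ X (col x)]a !atE eq_sym e andbT; lia.
- apply: Or43; split=> //=; rewrite -b [X in at_ (row y) X]a !atE e andbT; lia.
- apply: Or44; split=> //=; rewrite -b -[X in at_ (row x) X]a !atE eq_sym e andbT; lia.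
Qed.

Lemma block_joined x y : joined (field_of P) x y -> pblock P x == pblock P y.
Proof.
case=> [[a b /= /andP[_ c]]|[a b /= /andP[_ c]]|[a b /= /andP[_ c]]|[a b /= /andP[_ c]]].
- by move: c; rewrite -b -[X in at_ X (col y)]a !atE.
- by move: c; rewrite -b [X in at_ X (col x)]a !atE eq_sym.
- by move: c; rewrite -b -[X in at_ (row y) X]a !atE.
- by move: c; rewrite -b [X in at_ (row x) X]a !atE eq_sym.
Qed.

Lemma field_of_matching : matching (field_of P).
Proof.
have two x y z : x != y -> x != z -> y != z ->
    pblock P x == pblock P y -> pblock P x == pblock P z -> False by exact: block_two.
have ne i j i' j' : (0 <= i <= Z.of_nat K)%Z -> (0 <= j <= Z.of_nat K)%Z ->
    (0 <= i' <= Z.of_nat K)%Z -> (0 <= j' <= Z.of_nat K)%Z -> (i <> i' \/ j <> j')%Z ->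
    at_ i j != at_ i' j'.
  move=> h1 h2 h3 h4 h; apply/eqP => e.
  by have := @row_at i j h1; have := @col_at i j h2; rewrite e row_at // col_at //; lia.
split=> /=.
- move=> i j _ -> /andP[b1 e1] /andP[b2 e2].
  rewrite eq_sym in e1; apply: (two _ _ _ _ _ _ e1 e2); apply: ne; lia.
- move=> i _ j -> /andP[b1 e1] /andP[b2 e2].
  rewrite eq_sym in e1; apply: (two _ _ _ _ _ _ e1 e2); apply: ne; lia.
- move=> i j i' j' ei ej /andP[b1 e1] /andP[b2 e2].
  (* [oj] is the other one of j and j + 1, and [oi] the other one of i and i + 1: the common cell
     (i',j') would share its tile with two further cells. *)
  pose oj := (2 * j + 1 - j')%Z; pose oi := (2 * i + 1 - i')%Z.
  apply: (two (at_ i' j') (at_ i' oj) (at_ oi j')); try (by apply: ne; rewrite /oi /oj; lia).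
    rewrite /oj; case: ej => ->; last by rewrite (_ : 2 * j + 1 - (j + 1) = j)%Z 1?eq_sym //; lia.
    by rewrite (_ : 2 * j + 1 - j = j + 1)%Z //; lia.
  rewrite /oi; case: ei => ->; last by rewrite (_ : 2 * i + 1 - (i + 1) = i)%Z 1?eq_sym //; lia.
  by rewrite (_ : 2 * i + 1 - i = i + 1)%Z //; lia.
Qed.

End OfTiling.

Lemma card_four (T : finType) (a b c d : T) : uniq [:: a; b; c; d] ->
  #|[set a; b; c; d]| = 4.
Proof.
move=> u; have -> : [set a; b; c; d] = [set u in [:: a; b; c; d]].
  by apply/setP => z; rewrite !inE -!orbA.
by rewrite cardsE; move/card_uniqP: u.
Qed.

(** Diagonally opposite cells never share a tile, so fewer than four tiles at a point means that two
    side-adjacent cells share one. *)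
Lemma field_of_covers P : tatami P -> covers 0 (Z.of_nat K - 1) (field_of P).
Proof.
case/andP=> tP tc i j [hi hj].
have hi1 : Z.to_nat i < K.+1 by lia.
have hi2 : Z.to_nat (i + 1) < K.+1 by lia.
have hj1 : Z.to_nat j < K.+1 by lia.
have hj2 : Z.to_nat (j + 1) < K.+1 by lia.
have := tc => /forallP/(_ (inord (Z.to_nat i)))/forallP/(_ (inord (Z.to_nat (i + 1)))).
move=> /forallP/(_ (inord (Z.to_nat j)))/forallP/(_ (inord (Z.to_nat (j + 1)))).
rewrite !inordK // => /implyP H; have {}H := H ltac:(lia).
set a := at_ i j; set b := at_ i (j + 1); set c := at_ (i + 1) j; set d := at_ (i + 1) (j + 1).
rewrite /up /dn /lf /rt /=.
have -> : [&& 0 <=? i, i <=? Z.of_nat K, 0 <=? j & j <? Z.of_nat K]%Z by lia.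
have -> : [&& 0 <=? i + 1, i + 1 <=? Z.of_nat K, 0 <=? j & j <? Z.of_nat K]%Z by lia.
have -> : [&& 0 <=? i, i <? Z.of_nat K, 0 <=? j & j <=? Z.of_nat K]%Z by lia.
have -> : [&& 0 <=? i, i <? Z.of_nat K, 0 <=? j + 1 & j + 1 <=? Z.of_nat K]%Z by lia.
rewrite -/a -/b -/c -/d !andTb; apply/negPn/negP; rewrite !negb_or => /and4P[n1 n2 n3 n4].
move: H; rewrite -/(at_ i j) -/(at_ i (j + 1)) -/(at_ (i + 1) j) -/(at_ (i + 1) (j + 1)).
rewrite -/a -/b -/c -/d !imsetU !imset_set1 card_four //=.
have diag x y : (row y <> row x)%Z -> (col y <> col x)%Z -> pblock P x != pblock P y.
  move=> h1 h2; apply/negP => /(block_adjacent tP) H.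
  have /H : x != y by apply/eqP => e; rewrite e in h1.
  by move/adjacentP; lia.
have d1 : pblock P a != pblock P d.
  by apply: diag; rewrite /a /d ?row_at ?col_at; lia.
have d2 : pblock P b != pblock P c.
  by apply: diag; rewrite /b /c ?row_at ?col_at; lia.
by rewrite !inE !negb_or n1 n2 n3 n4 d1 d2.
Qed.

Definition joinedb f x y : bool :=
  [|| [&& row y =? row x, col y =? col x + 1 & eh f (row x) (col x)],
      [&& row y =? row x, col x =? col y + 1 & eh f (row y) (col y)],
      [&& col y =? col x, row y =? row x + 1 & ev f (row x) (col x)] |
      [&& col y =? col x, row x =? row y + 1 & ev f (row y) (col y)]]%Z.

Lemma joinedP f x y : reflect (joined f x y) (joinedb f x y).
Proof.
apply: (iffP or4P) => -[].
- by case/and3P=> /Z.eqb_eq a /Z.eqb_eq b c; apply: Or41.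
- by case/and3P=> /Z.eqb_eq a /Z.eqb_eq b c; apply: Or42.
- by case/and3P=> /Z.eqb_eq a /Z.eqb_eq b c; apply: Or43.
- by case/and3P=> /Z.eqb_eq a /Z.eqb_eq b c; apply: Or44.
- by case=> /Z.eqb_eq a /Z.eqb_eq b c; apply: Or41; apply/and3P.
- by case=> /Z.eqb_eq a /Z.eqb_eq b c; apply: Or42; apply/and3P.
- by case=> /Z.eqb_eq a /Z.eqb_eq b c; apply: Or43; apply/and3P.
- by case=> /Z.eqb_eq a /Z.eqb_eq b c; apply: Or44; apply/and3P.
Qed.

Definition tile f x := [set y | (y == x) || joinedb f x y].
Definition tiling_of f : {set {set cel}} := [set tile f x | x in [set: cel]].

Lemma tile_refl f x : x \in tile f x. Proof. by rewrite inE eqxx. Qed.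

Lemma joined_neq f x y : joined f x y -> x != y.
Proof. by move=> h; apply/eqP => e; move: h; rewrite e => -[] []; lia. Qed.

Lemma tile_cases f x : matching f ->
  tile f x = [set x] \/ exists2 y, joined f x y & tile f x = [set x; y].
Proof.
move=> m; case: (pickP (joinedb f x)) => [y /joinedP h|h]; [right|left].
  exists y => //; apply/setP => z; rewrite !inE; congr orb.
  by apply/joinedP/eqP => [h'|->] //; exact: joined_uniq h' h.
by apply/setP => z; rewrite !inE h orbF.
Qed.

Lemma tile_eq f x y : matching f -> y \in tile f x -> tile f y = tile f x.
Proof.
move=> m; rewrite inE => /orP[/eqP->//|/joinedP h].
apply/setP => z; rewrite !inE; apply/orP/orP.
- case=> [/eqP->|/joinedP h']; first by right; apply/joinedP.
  by left; apply/eqP; apply: joined_uniq h' (joined_sym h).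
- case=> [/eqP->|/joinedP h']; first by right; apply/joinedP/joined_sym.
  by left; apply/eqP; apply: joined_uniq h' h.
Qed.

Section OfField.
Variable f : field.
Hypothesis m : matching f.

Lemma tiling_of_partition : partition (tiling_of f) [set: cel].
Proof.
apply/and3P; split.
- rewrite eqEsubset subsetT /=; apply/subsetP => x _; apply/bigcupP.
  by exists (tile f x); [apply: imset_f; rewrite inE|exact: tile_refl].
- apply/trivIsetP => B C /imsetP[x _ ->] /imsetP[y _ ->] ne.
  apply/pred0P => z /=; apply/negP => /andP[hx hy].
  by rewrite -(tile_eq m hx) -(tile_eq m hy) eqxx in ne.
- by apply/imsetP => -[x _ e]; have := tile_refl f x; rewrite -e inE.
Qed.

Lemma pblock_tiling_of x : pblock (tiling_of f) x = tile f x.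
Proof.
have /and3P[_ triv _] := tiling_of_partition.
by apply: def_pblock => //; [apply: imset_f; rewrite inE|exact: tile_refl].
Qed.

Lemma tiling_of_mono_dimer : mono_dimer_tiling (tiling_of f).
Proof.
rewrite /mono_dimer_tiling tiling_of_partition /=.
apply/forallP => B; apply/implyP => /imsetP[x _ ->].
case: (tile_cases x m) => [->|[y h ->]]; first by rewrite /is_monomer cards1.
by apply/orP; right; apply/existsP; exists x; apply/existsP; exists y;
  rewrite eqxx (joined_adjacent h).
Qed.

Lemma tile_joined x y : x != y -> (tile f x == tile f y) = joinedb f x y.
Proof.
move=> xy; apply/eqP/idP => [e|h].
  by have := tile_refl f y; rewrite -e inE eq_sym (negbTE xy).
by apply/esym/tile_eq => //; rewrite inE h orbT.
Qed.

Lemma field_of_tiling_of_h i j : (0 <= i <= Z.of_nat K)%Z -> (0 <= j < Z.of_nat K)%Z ->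
  eh (field_of (tiling_of f)) i j = eh f i j.
Proof.
move=> hi hj /=; have -> /= : [&& 0 <=? i, i <=? Z.of_nat K, 0 <=? j & j <? Z.of_nat K]%Z by lia.
have hj1 : (0 <= j <= Z.of_nat K)%Z by lia.
have hj2 : (0 <= j + 1 <= Z.of_nat K)%Z by lia.
rewrite !pblock_tiling_of tile_joined; last first.
  by apply/eqP => /(congr1 (fun x => col x)); rewrite !col_at //; lia.
apply/joinedP/idP => [|h].
  by case; rewrite !row_at // !col_at // => -[]; lia.
by apply: Or41; rewrite !row_at // !col_at.
Qed.

Lemma field_of_tiling_of_v i j : (0 <= i < Z.of_nat K)%Z -> (0 <= j <= Z.of_nat K)%Z ->
  ev (field_of (tiling_of f)) i j = ev f i j.
Proof.
move=> hi hj /=; have -> /= : [&& 0 <=? i, i <? Z.of_nat K, 0 <=? j & j <=? Z.of_nat K]%Z by lia.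
have hi1 : (0 <= i <= Z.of_nat K)%Z by lia.
have hi2 : (0 <= i + 1 <= Z.of_nat K)%Z by lia.
rewrite !pblock_tiling_of tile_joined; last first.
  by apply/eqP => /(congr1 (fun x => row x)); rewrite !row_at //; lia.
apply/joinedP/idP => [|h].
  by case; rewrite !row_at // !col_at // => -[]; lia.
by apply: Or43; rewrite !row_at // !col_at.
Qed.

Lemma tatami_tiling_of : covers 0 (Z.of_nat K - 1) f -> tatami (tiling_of f).
Proof.
move=> C; rewrite /tatami tiling_of_mono_dimer /=.
apply/forallP => i1; apply/forallP => i2; apply/forallP => j1; apply/forallP => j2.
apply/implyP => /andP[/eqP ei /eqP ej].
have le3 (a b c : cel) : #|[set a; b; c]| <= 3.
  apply: leq_trans (leq_card_setU _ _) _; rewrite cards1 addn1 ltnS cards2.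
  by case: (a != b).
(* Two of the four cells in one tile leave at most three tiles. *)
have key (a b c d : cel) : pblock (tiling_of f) a = pblock (tiling_of f) b ->
    #|pblock (tiling_of f) @: ([set a; b] :|: [set c; d])| < 4.
  move=> e; rewrite !imsetU !imset_set1 e setUid.
  rewrite -!imset_set1 -!imsetU setUA; apply: leq_ltn_trans (leq_imset_card _ _) _.
  exact: le3.
have eqb (x y : cel) : joinedb f x y -> pblock (tiling_of f) x = pblock (tiling_of f) y.
  by move=> h; rewrite !pblock_tiling_of; apply/esym/tile_eq => //; rewrite inE h orbT.
have s : sq 0 (Z.of_nat K - 1) (Z.of_nat i1) (Z.of_nat j1).
  by unfold sq; have := ltn_ord i2; have := ltn_ord j2; lia.
have ri : Z.of_nat i2 = (Z.of_nat i1 + 1)%Z by lia.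
have rj : Z.of_nat j2 = (Z.of_nat j1 + 1)%Z by lia.
case/or4P: (C _ _ s); rewrite /up /dn /lf /rt => h.
- rewrite -setUA; apply: key.
  by apply/eqb/joinedP/Or41; split.
- rewrite -setUA setUC; apply: key.
  by apply/eqb/joinedP/Or41; split; rewrite /row /col /= ?ri.
- have -> : [set (i1, j1); (i1, j2); (i2, j1); (i2, j2)] =
     [set (i1, j1); (i2, j1)] :|: [set (i1, j2); (i2, j2)].
    by rewrite !setUA -[X in X :|: _]setUA [[set (i1, j2)] :|: _]setUC setUA.
  by apply: key; apply/eqb/joinedP/Or43; split.
- have -> : [set (i1, j1); (i1, j2); (i2, j1); (i2, j2)] =
     [set (i1, j2); (i2, j2)] :|: [set (i1, j1); (i2, j1)].
    by rewrite [RHS]setUC !setUA -[X in X :|: _]setUA [[set (i1, j2)] :|: _]setUC setUA.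
  by apply: key; apply/eqb/joinedP/Or43; split; rewrite /row /col /= ?rj.
Qed.

End OfField.

Lemma tiling_of_ext f g :
  (forall i j, (0 <= i <= Z.of_nat K)%Z -> (0 <= j < Z.of_nat K)%Z -> eh f i j = eh g i j) ->
  (forall i j, (0 <= i < Z.of_nat K)%Z -> (0 <= j <= Z.of_nat K)%Z -> ev f i j = ev g i j) ->
  tiling_of f = tiling_of g.
Proof.
move=> eH eV; apply: eq_imset => x; apply/setP => y; rewrite !inE; congr orb.
have := row_bound x; have := row_bound y; have := col_bound x; have := col_bound y.
move=> c1 c2 c3 c4; rewrite /joinedb; congr [|| _, _, _ | _].
- by case: Z.eqb_spec => //= a; case: Z.eqb_spec => //= b; apply: eH; lia.
- by case: Z.eqb_spec => //= a; case: Z.eqb_spec => //= b; apply: eH; lia.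
- by case: Z.eqb_spec => //= a; case: Z.eqb_spec => //= b; apply: eV; lia.
- by case: Z.eqb_spec => //= a; case: Z.eqb_spec => //= b; apply: eV; lia.
Qed.

Lemma tiling_of_field_of P : mono_dimer_tiling P -> tiling_of (field_of P) = P.
Proof.
move=> tP; have /andP[part _] := tP; have /and3P[/eqP cov triv _] := part.
have tE x : tile (field_of P) x = pblock P x.
  apply/setP => y; rewrite -(same_block tP) inE eq_sym.
  case: (boolP (x == y)) => [/eqP->|xy] /=; first by rewrite eqxx.
  by apply/joinedP/idP; [exact: block_joined|exact: joined_block].
apply/setP => B; apply/imsetP/idP => [[x _ ->]|flipB].
  by rewrite tE; exact: pblock_tile.
have /set0Pn[x hx] : B != set0.
  by apply: contraTneq flipB => ->; case/and3P: part.
by exists x => //; rewrite tE (def_pblock triv flipB hx).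
Qed.

End Tilings.

(** * Counting the monomers *)

Section Counting.
Variable K : nat.
Notation cel := (cell K.+1 K.+1).

Definition in_range_eq f g :=
  (forall i j, (0 <= i <= Z.of_nat K)%Z -> (0 <= j < Z.of_nat K)%Z -> eh f i j = eh g i j) /\
  (forall i j, (0 <= i < Z.of_nat K)%Z -> (0 <= j <= Z.of_nat K)%Z -> ev f i j = ev g i j).

Lemma weight_ext f g : in_range_eq f g -> weight 0 K f = weight 0 K g.
Proof.
case=> eH eV; rewrite /weight; congr (2 * (_ + _)); apply: eq_bigr => p _;
  apply: eq_bigr => q _; have := ltn_ord p; have := ltn_ord q => h1 h2.
- by rewrite eH //; lia.
- by rewrite eV //; lia.
Qed.

(** Each dimer is seen from both of its cells; this is the factor 2 in [weight]. *)
Lemma weight_cells f :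
  (forall i j, eh f i j -> (0 <= j < Z.of_nat K)%Z) ->
  (forall i j, ev f i j -> (0 <= i < Z.of_nat K)%Z) ->
  \sum_(x : cel) (eh f (row x) (col x) + eh f (row x) (col x - 1)
    + ev f (row x) (col x) + ev f (row x - 1) (col x)) = weight 0 K f.
Proof.
move=> bh bv.
pose F (i j : nat) : nat := eh f (Z.of_nat i) (Z.of_nat j)
  + eh f (Z.of_nat i) (Z.of_nat j - 1)
  + ev f (Z.of_nat i) (Z.of_nat j) + ev f (Z.of_nat i - 1) (Z.of_nat j).
transitivity (\sum_(i < K.+1) \sum_(j < K.+1) F i j).
  by rewrite pair_big.
have hz i j : ~ (0 <= j < Z.of_nat K)%Z -> eh f i j = false.
  by move=> h; apply/negP => /bh.
have vz i j : ~ (0 <= i < Z.of_nat K)%Z -> ev f i j = false.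
  by move=> h; apply/negP => /bv.
have e1 : \sum_(i < K.+1) \sum_(j < K.+1) eh f (Z.of_nat i) (Z.of_nat j)
    = \sum_(i < K.+1) \sum_(j < K) eh f (Z.of_nat i) (Z.of_nat j) :> nat.
  apply: eq_bigr => i _; rewrite big_ord_recr /= hz ?addn0; last by lia.
  by apply: eq_bigr.
have e2 : \sum_(i < K.+1) \sum_(j < K.+1) eh f (Z.of_nat i) (Z.of_nat j - 1)
    = \sum_(i < K.+1) \sum_(j < K) eh f (Z.of_nat i) (Z.of_nat j) :> nat.
  apply: eq_bigr => i _; rewrite big_ord_recl (hz _ (Z.of_nat (@ord0 K) - 1)%Z) ?add0n; last by rewrite /=; lia.
  by apply: eq_bigr => j _; congr (nat_of_bool (eh f _ _)); rewrite lift0; lia.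
have e3 : \sum_(i < K.+1) \sum_(j < K.+1) ev f (Z.of_nat i) (Z.of_nat j)
    = \sum_(i < K) \sum_(j < K.+1) ev f (Z.of_nat i) (Z.of_nat j) :> nat.
  rewrite big_ord_recr /= [X in _ + X]big1 ?addn0; last by move=> j _; rewrite vz //; lia.
  by apply: eq_bigr => i _; apply: eq_bigr.
have e4 : \sum_(i < K.+1) \sum_(j < K.+1) ev f (Z.of_nat i - 1) (Z.of_nat j)
    = \sum_(i < K) \sum_(j < K.+1) ev f (Z.of_nat i) (Z.of_nat j) :> nat.
  rewrite big_ord_recl [X in X + _]big1 ?add0n; last by move=> j _; rewrite vz //; rewrite /=; lia.
  apply: eq_bigr => i _; apply: eq_bigr => j _.
  by congr (nat_of_bool (ev f _ _)); rewrite lift0; lia.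
rewrite /weight /F.
under eq_bigr => i _ do rewrite !big_split /=.
by rewrite !big_split /= e1 e2 e3 e4 /=; lia.
Qed.

(** A cell is a monomer or has exactly one partner among its four neighbours; summed over all cells
    this relates [num_monomers] to [weight]. *)
Lemma block_degree (P : {set {set cel}}) (x : cel) : mono_dimer_tiling P ->
  (pblock P x == [set x]) + (eh (field_of P) (row x) (col x)
    + eh (field_of P) (row x) (col x - 1) + ev (field_of P) (row x) (col x)
    + ev (field_of P) (row x - 1) (col x)) = 1.
Proof.
move=> tP; set f := field_of P.
have m : matching f := field_of_matching tP.
have [H V X] := m.
have hx := row_bound x; have kx := col_bound x.
have bh i j : eh f i j -> (0 <= i <= Z.of_nat K /\ 0 <= j < Z.of_nat K)%Z.
  by move=> /andP[] h _; lia.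
have bv i j : ev f i j -> (0 <= i < Z.of_nat K /\ 0 <= j <= Z.of_nat K)%Z.
  by move=> /andP[] h _; lia.
have mono : pblock P x == [set x] -> forall y, ~ joined f x y.
  move=> /eqP e y h; have := block_joined h.
  rewrite (same_block tP) e inE => /eqP e'.
  by have := joined_neq h; rewrite e' eqxx.
have c1 : eh f (row x) (col x) -> joined f x (at_ K (row x) (col x + 1)).
  by move=> h; have := bh _ _ h => b; apply: Or41; rewrite row_at ?col_at //; lia.
have c2 : eh f (row x) (col x - 1) -> joined f x (at_ K (row x) (col x - 1)).
  by move=> h; have := bh _ _ h => b; apply: Or42; rewrite row_at ?col_at //; try lia; split=> //; lia.
have c3 : ev f (row x) (col x) -> joined f x (at_ K (row x + 1) (col x)).
  by move=> h; have := bv _ _ h => b; apply: Or43; rewrite row_at ?col_at //; lia.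
have c4 : ev f (row x - 1) (col x) -> joined f x (at_ K (row x - 1) (col x)).
  by move=> h; have := bv _ _ h => b; apply: Or44; rewrite row_at ?col_at //; try lia; split=> //; lia.
have d12 : eh f (row x) (col x) -> eh f (row x) (col x - 1) = false.
  by move=> h; apply/negP => h'; apply: H h' h; lia.
have d34 : ev f (row x) (col x) -> ev f (row x - 1) (col x) = false.
  by move=> h; apply/negP => h'; apply: V h' h; lia.
have p v : ev f v (col x) -> (row x = v \/ row x = v + 1)%Z ->
    eh f (row x) (col x) = false /\ eh f (row x) (col x - 1) = false.
  by move=> h hv; split; apply/negP => h'; apply: (X _ _ _ _ _ _ h' h); lia.
have q3 h := p _ h (or_introl (erefl (row x))).
have q4 h := p _ h (or_intror (ltac:(lia) : row x = row x - 1 + 1)%Z).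
have none : pblock P x == [set x] = false ->
    [|| eh f (row x) (col x), eh f (row x) (col x - 1), ev f (row x) (col x)
      | ev f (row x - 1) (col x)].
  move=> n; have : exists2 y, y != x & pblock P x == pblock P y.
    case: (pickP (fun y => (y != x) && (pblock P x == pblock P y))) => [y /andP[]|h].
      by exists y.
    case/negP: (negbT n); rewrite eqEsubset sub1set in_pblock // andbT.
    apply/subsetP => y; rewrite -same_block // inE => e.
    by have := h y; rewrite e andbT => /negbFE.
  case=> y; rewrite eq_sym => xy e; case: (joined_block tP xy e).
  - by case=> _ _ ->.
  - by case=> -> -> h; rewrite (_ : col y + 1 - 1 = col y)%Z ?h ?orbT //; lia.
  - by case=> _ _ ->; rewrite !orbT.
  - by case=> -> -> h; rewrite (_ : row y + 1 - 1 = row y)%Z ?h ?orbT //; lia.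
case E: (pblock P x == [set x]).
  have z (b : bool) y : (b -> joined f x y) -> b = false.
    by move=> h; apply/negP => /h; apply: mono.
  by rewrite (z _ _ c1) (z _ _ c2) (z _ _ c3) (z _ _ c4).
move: (none E) d12 d34 q3 q4.
case: (eh f (row x) (col x)); case: (eh f (row x) (col x - 1));
  case: (ev f (row x) (col x)); case: (ev f (row x - 1) (col x)) => //= _ a b c d;
  first [by have := a isT | by have := b isT | by have [] := c isT | by have [] := d isT].
Qed.

Lemma monomers_weight (P : {set {set cel}}) : mono_dimer_tiling P ->
  num_monomers P + weight 0 K (field_of P) = K.+1 * K.+1.
Proof.
move=> tP; rewrite -weight_cells; last 2 first.
- by move=> i j /andP[] h _; lia.
- by move=> i j /andP[] h _; lia.
have -> : num_monomers P = #|[set x : cel | pblock P x == [set x]]|.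
  rewrite -(card_imset _ set1_inj) /num_monomers; apply: eq_card => B.
  have /and3P[/eqP cov triv _] : partition P [set: cel] by case/andP: tP.
  rewrite !inE; apply/andP/imsetP => [[flipB /cards1P[x e]]|[x]].
    exists x => //; rewrite inE (def_pblock triv flipB) ?e //.
    by rewrite inE.
  rewrite inE => /eqP e ->; split; last by rewrite /is_monomer cards1.
  by rewrite -e; exact: pblock_tile.
rewrite -sum1_card big_mkcond /= -big_split /=.
rewrite (eq_bigr (fun=> 1)) => [|x _]; last first.
  by rewrite inE; have := block_degree x tP; case: (pblock P x == [set x]).
by rewrite sum1_card card_prod !card_ord.
Qed.

End Counting.

(** * Assembling the count *)

(** The equality case was proved for at least two points per side. With a single point [weight] is
    twice its degree, and [back] is vacuous. *)
Lemma one_good f : matching f -> covers 0 0 f -> weight 0 1 f = 2 -> good 0 0 f.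
Proof.
move=> m C e; split=> //.
- move=> i j [hi hj]; have -> : i = 0%Z by lia. have -> : j = 0%Z by lia.
  move: e; rewrite /weight !big_ord_recl !big_ord0 /deg /up /dn /lf /rt /=.
  by change (Z.of_nat (bump 0 0)) with 1%Z; change (Z.of_nat 0) with 0%Z; lia.
- by move=> k; split=> i j s s'; sqlia.
Qed.

Lemma weight_good L f : matching f -> covers 0 (Z.of_nat L) f ->
  weight 0 L.+1 f = L.+1 * L.+1 + L.+1 -> good 0 (Z.of_nat L) f.
Proof. by case: L => [|L]; [exact: one_good|exact: tight_good]. Qed.

Section Final.
Variable M : nat.
Let K := M.+1.
Notation tl := (tiling_of K).

Lemma agree_in_range f g : agree M f g -> in_range_eq K f g.
Proof.
move=> ag; split=> i j hi hj.
  (* The last row of cells has no points below it; its dimers are the [dn] of the last row of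
     points. *)
  have [h|h] : (i < Z.of_nat K \/ i = Z.of_nat K)%Z by lia.
    by have [|u _ _ _] := ag i j; [unfold sq; rewrite /K in h hi hj *; lia|exact: u].
  have [|_ h2 _ _] := ag (i - 1)%Z j; first by unfold sq; rewrite /K in h hi hj *; lia.
  by move: h2; rewrite /dn; have -> : (i - 1 + 1 = i)%Z by lia.
have [h|h] : (j < Z.of_nat K \/ j = Z.of_nat K)%Z by lia.
  by have [|_ _ l _] := ag i j; [unfold sq; rewrite /K in h hi hj *; lia|exact: l].
have [|_ _ _ h2] := ag i (j - 1)%Z; first by unfold sq; rewrite /K in h hi hj *; lia.
by move: h2; rewrite /rt; have -> : (j - 1 + 1 = j)%Z by lia.
Qed.

Lemma in_range_agree f g : in_range_eq K f g -> agree M f g.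
Proof.
case=> eH eV i j [hi hj]; rewrite /same /up /dn /lf /rt.
by rewrite !eH ?eV //; rewrite /K; lia.
Qed.

Lemma good_tatami f : good 0 (Z.of_nat M + 1 - 1) f ->
  tatami (tl f) /\ num_monomers (tl f) = K.+1.
Proof.
move=> g; have m := g_m g.
have eK : (Z.of_nat M + 1 - 1 = Z.of_nat K - 1)%Z by rewrite /K; lia.
have t : tatami (tl f) by apply: tatami_tiling_of => //; rewrite -eK; exact: g_c g.
split=> //.
have := monomers_weight (tiling_of_mono_dimer K m).
have -> : weight 0 K (field_of (tl f)) = weight 0 K f.
  by apply: weight_ext; split=> i j; [exact: field_of_tiling_of_h|exact: field_of_tiling_of_v].
rewrite (good_weight (M := K)); last by have -> : (0 +z K - 1 = Z.of_nat M + 1 - 1)%Z by lia.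
lia.
Qed.

Lemma tatami_good (P : {set {set cell K.+1 K.+1}}) : tatami P -> num_monomers P = K.+1 ->
  good 0 (Z.of_nat M + 1 - 1) (field_of P).
Proof.
move=> t nm; have tP : mono_dimer_tiling P by case/andP: t.
have m := field_of_matching tP; have C := field_of_covers t.
have w : weight 0 K (field_of P) = K * K + K.
  by have := monomers_weight tP; rewrite nm; lia.
have eM : (Z.of_nat M + 1 - 1 = Z.of_nat M)%Z by lia.
rewrite eM; apply: weight_good => //; move: C.
by have -> : (Z.of_nat K - 1 = Z.of_nat M)%Z by lia.
Qed.

Definition symmetries : seq (bool * bool) :=
  [:: (false, false); (false, true); (true, false); (true, true)].

Definition tilings := [seq tl (sym M c (code M w)) | c <- symmetries, w <- words M].

Lemma tilings_uniq : uniq tilings.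
Proof.
apply: allpairs_uniq => //; first exact: uniq_words.
move=> [c w] [c' w'] /allpairsP[[c1 w1] [_ hw [-> ->]]] /allpairsP[[c2 w2] [_ hw' [-> ->]]] /= e.
apply: (@sym_code_inj M) => //; apply: in_range_agree.
have g1 := good_sym c1 (good_code hw); have g2 := good_sym c2 (good_code hw').
split=> i j hi hj.
  by rewrite -(field_of_tiling_of_h (g_m g1) hi hj) e field_of_tiling_of_h //; exact: g_m g2.
by rewrite -(field_of_tiling_of_v (g_m g1) hi hj) e field_of_tiling_of_v //; exact: g_m g2.
Qed.

Lemma mem_tilings P : (P \in tilings) = tatami P && (num_monomers P == K.+1).
Proof.
apply/allpairsP/andP => [[[c w] [_ hw ->]]|[t /eqP nm]].
  by have [-> ->] := good_tatami (good_sym c (good_code hw)).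
have [c [w hw ag]] := sym_code_surj (tatami_good t nm).
exists (c, w); split=> //=; first by case: c {ag} => [[] []].
rewrite -[LHS](tiling_of_field_of (P := P)); last by case/andP: t.
by have [eH eV] := agree_in_range ag; apply: tiling_of_ext.
Qed.

Lemma count_square : T K.+1 K.+1 K.+1 = K.+1 * 2 ^ K.
Proof.
rewrite /T (eq_card (B := mem tilings)); last by move=> P; rewrite inE mem_tilings.
rewrite (card_uniqP tilings_uniq) size_allpairs /=.
(* Here n = M + 2, and the four symmetries quadruple the (M + 2) * 2 ^ (M - 1) words. *)
by have := size_words M; rewrite /K expnS; lia.
Qed.

End Final.

Lemma count_one : T 1 1 1 = 1.
Proof.
pose f0 := Field (fun _ _ => false) (fun _ _ => false).
apply/eqP/cards1P; exists (tiling_of 0 f0); apply/setP => P; rewrite !inE.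
have m0 : matching f0 by split.
apply/andP/eqP => [[t _]|->].
  rewrite -[LHS](tiling_of_field_of (P := P)); last by case/andP: t.
  by apply: tiling_of_ext => i j /= *; lia.
have t : tatami (tiling_of 0 f0).
  by apply: tatami_tiling_of => // i j []; lia.
split=> //; have := monomers_weight (tiling_of_mono_dimer 0 m0).
by rewrite /weight !big_ord_recl !big_ord0; lia.
Qed.

Theorem theorem2 (n : nat) : 1 <= n -> T n n n = n * 2 ^ n.-1.
Proof.
case: n => [|[|M]] // _; first by rewrite count_one.
exact: count_square.
Qed.
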